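(* Let $n$ be a positive integer. For every $U_0\in C_0^\infty(\mathbb{H}^n)$, the Poisson problem on the hyperbolic space $\mathbb{H}^n$ $$\mathcal{L}_n U(y,w)=-\frac{\partial^2}{\partial y^2}U(y,w),\quad (y,w)\in\mathbb{R}^+\times\mathbb{H}^n,\qquad U(0,w)=U_0(w),$$ has the solution given by $$U(y,w)=\int_{\mathbb{H}^n}P_n^{\mathbb{H}}(y,w,w')\,U_0(w')\,d\mu(w'),$$ with $$P_n^{\mathbb{H}}(y,w,w')=\frac{\Gamma((n+1)/2)}{\pi^{(n+1)/2}}\,\frac{\sin y}{\left(2\cosh\rho(w,w')-2\cos y\right)^{(n+1)/2}}.$$
   Context: $\mathbb{R}^+=(0,\infty)$. $\mathbb{H}^n=\{w=(x_1,\dots,x_n)\in\mathbb{R}^n: x_n>0\}$ is the upper half space with metric $ds^2=x_n^{-2}(dx_1^2+\dots+dx_n^2)$, volume form $d\mu(w)=x_n^{-n}\,dx_1\cdots dx_n$, and hyperbolic distance $\rho(w,w')$ given by $\cosh^2(\rho(w,w')/2)=\frac{|w-w'|^2}{4x_nx_n'}+1$, where $|\cdot|$ is the Euclidean norm. The (shifted) Laplace–Beltrami operator is $$\mathcal{L}_n=x_n^2\Delta_{n-1}+x_n^2\frac{\partial^2}{\partial x_n^2}+(2-n)x_n\frac{\partial}{\partial x_n}+\frac{(n-1)^2}{4},\qquad \Delta_{n-1}=\sum_{j=1}^{n-1}\frac{\partial^2}{\partial x_j^2},$$ acting in the variable $w$. $C_0^\infty$ denotes smooth compactly supported functions. The initial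 condition is understood as the limit as $y\to0^+$.
   Formalization: The equation is asserted at all (y,w) in R^+ × H^n except y = 2πk (k ≥ 1) with w in supp U_0: there the kernel is 0/0 at w' = w, and U jumps from -U_0(w) to U_0(w) across y = 2πk, so the equation fails whenever U_0(w) ≠ 0. *)

(* Defs.v *)
From HB Require Import structures.
From mathcomp Require Import all_boot all_order all_algebra.
From mathcomp Require Import all_classical all_reals all_analysis.
From mathcomp Require Import ring lra.
Set Implicit Arguments.
Unset Strict Implicit.
Unset Printing Implicit Defensive.
Import Order.TTheory GRing.Theory Num.Theory.
Import numFieldNormedType.Exports.
Local Open Scope classical_set_scope.
Local Open Scope ring_scope.

Section tcons_measure.
Context {R : realType} {n : nat}.
Local Notation T := (n.-tuple (measurableTypeR R)).
Variable mu : {sigma_finite_measure set T -> \bar R}.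

Definition tcons (p : measurableTypeR R * T) : n.+1.-tuple (measurableTypeR R) :=
  [the n.+1.-tuple _ of p.1 :: p.2].

Lemma measurable_tcons : measurable_fun setT tcons.
Proof. exact: (measurable_cons measurable_fst measurable_snd). Qed.

Definition tcons_measure : set (n.+1.-tuple (measurableTypeR R)) -> \bar R :=
  pushforward (lebesgue_measure \x mu)%E tcons.

Let tcons_measure0 : tcons_measure set0 = 0%E.
Proof. by rewrite /tcons_measure /pushforward preimage_set0 measure0. Qed.

Let tcons_measure_ge0 A : (0 <= tcons_measure A)%E.
Proof. by rewrite /tcons_measure /pushforward measure_ge0. Qed.

Let tcons_measure_sigma_additive : semi_sigma_additive tcons_measure.
Proof.
move=> F mF tF mUF; rewrite /tcons_measure /pushforward preimage_bigcup.
have mpre A : measurable A -> measurable (tcons @^-1` A).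
  by move=> mA; rewrite -[X in measurable X]setTI; exact: measurable_tcons.
apply: measure_semi_sigma_additive.
- by move=> k; exact: mpre.
- apply/trivIsetP => /= i j _ _ ij; rewrite -preimage_setI.
  by move/trivIsetP : tF => /(_ _ _ _ _ ij) ->//; rewrite preimage_set0.
- by rewrite -preimage_bigcup; exact: mpre.
Qed.

HB.instance Definition _ := isMeasure.Build _ _ _ tcons_measure
  tcons_measure0 tcons_measure_ge0 tcons_measure_sigma_additive.

Lemma tcons_measure_sigma_finite : sigma_finite setT tcons_measure.
Proof.
have msf : sigma_finite setT (lebesgue_measure \x mu)%E.
  have /sigma_finiteP[F [TF ndF Foo]] := sigma_finiteT (@lebesgue_measure R).
  have /sigma_finiteP[G [TG ndG Goo]] := sigma_finiteT mu.
  exists (fun k => F k `*` G k).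
    rewrite -setXTT TF TG predeqE => -[x y]; split.
      move=> [/= [i _ Fx] [k _ Gy]]; exists (maxn i k) => //; split.
      - by move: x Fx; exact/subsetPset/ndF/leq_maxl.
      - by move: y Gy; exact/subsetPset/ndG/leq_maxr.
    by move=> [i _ []/= ? ?]; split; exists i.
  move=> k; have [? ?] := Foo k; have [? ?] := Goo k.
  split; first exact: measurableX.
  by rewrite product_measure1E// lte_mul_pinfty// ge0_fin_numE.
have [F FT Ffin] := msf.
pose g (t : n.+1.-tuple (measurableTypeR R)) := (thead t, [tuple of behead t]).
have mg : measurable_fun setT g.
  apply/measurable_fun_pairP; split; last exact: measurable_behead.
  exact: (measurable_tnth ord0).
have gK x : g (tcons x) = x.
  by case: x => a t; rewrite /g /tcons; congr pair; apply/val_inj.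
exists (fun k => g @^-1` F k).
  by rewrite -preimage_bigcup -FT preimage_setT.
move=> k; have [mF Fk] := Ffin k; split.
  by rewrite -[X in measurable X]setTI; exact: mg.
rewrite /tcons_measure /pushforward -comp_preimage.
by rewrite (_ : g \o tcons = id)//; apply/funext => x /=; rewrite gK.
Qed.

HB.instance Definition _ := Measure_isSigmaFinite.Build _ _ _ tcons_measure
  tcons_measure_sigma_finite.

End tcons_measure.

Section lebesgue_Rn.
Context {R : realType}.

(* Iterated product of n copies of the Lebesgue measure of R; the dirac mass
   is the product of zero copies. *)
Fixpoint lebesgue_Rn (n : nat) :
    {sigma_finite_measure set (n.-tuple (measurableTypeR R)) -> \bar R} :=
  if n is k.+1 then tcons_measure (lebesgue_Rn k) else dirac [tuple].

Lemma lebesgue_Rn_box (n : nat) (A : 'I_n -> set (measurableTypeR R)) :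
  (forall i, measurable (A i)) ->
  lebesgue_Rn n [set t | forall i, A i (tnth t i)] =
  (\prod_(i < n) lebesgue_measure (A i))%E.
Proof.
elim: n A => [|n IH] A mA.
  by rewrite big_ord0 /= diracE mem_set//; case.
rewrite big_ord_recl -(IH (fun i => A (lift ord0 i)))//.
rewrite [lebesgue_Rn n.+1]/= /tcons_measure /pushforward.
rewrite -product_measure1E//; last first.
  rewrite (_ : mkset _ = \bigcap_(i in [set: 'I_n])
    ((fun t : n.-tuple (measurableTypeR R) => tnth t i) @^-1` A (lift ord0 i))).
    apply: fin_bigcap_measurable => // i _.
    by rewrite -[X in measurable X]setTI; exact: measurable_tnth.
  apply/seteqP; split => t /= At => [i _|i]; [exact: At|exact: (At i Logic.I)].
congr (product_measure1 _ _ _); apply/seteqP; split => -[a t] /=.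
  by move=> At; split=> [|i]; [exact: (At ord0)|have := At (lift ord0 i); rewrite tnthS].
move=> [Aa At] i; case: (unliftP ord0 i) => [j ->|->]; last exact: Aa.
by rewrite tnthS.
Qed.

End lebesgue_Rn.

Section partial_derivatives.
Context {R : realType} {m : nat}.
Implicit Types (f : 'rV[R]_m.+1 -> R) (D : set 'rV[R]_m.+1).

Definition basis_vec (i : 'I_m.+1) : 'rV[R]_m.+1 := delta_mx 0 i.

Definition partial (i : 'I_m.+1) f : 'rV[R]_m.+1 -> R := 'D_(basis_vec i) f.

Definition partials (s : seq 'I_m.+1) f : 'rV[R]_m.+1 -> R := foldr partial f s.

Definition smooth_on D f := forall (s : seq 'I_m.+1) (w : 'rV[R]_m.+1), D w ->
  {for w, continuous (partials s f)} /\
  forall i, derivable (partials s f) w (basis_vec i).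

End partial_derivatives.

Section hyperbolic_space.
Context {R : realType} {m : nat}.
Implicit Types (w z : 'rV[R]_m.+1) (f u : 'rV[R]_m.+1 -> R).

(* The dimension is n = m.+1; the coordinates are indexed from 0, so that x_n
   is the one of index ord_max. *)
Definition xlast w : R := w 0 ord_max.

Definition Hn : set 'rV[R]_m.+1 := [set w | 0 < xlast w].

(* The norm of the library on row vectors is the sup norm. *)
Definition sqr_dist w z : R := \sum_(i < m.+1) (w 0 i - z 0 i) ^+ 2.

Definition cosh (x : R) : R := (expR x + expR (- x)) / 2.

Definition hdist_spec w z (r : R) : Prop := 0 <= r /\
  cosh (r / 2) ^+ 2 = sqr_dist w z / (4 * xlast w * xlast z) + 1.

Definition hdist w z : R := get (hdist_spec w z).

(* Functions on H^n are represented by functions on R^n, whose values outside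
   of Hn are never used. *)
Definition hsupport u : set 'rV[R]_m.+1 :=
  closure [set w | Hn w /\ u w != 0].

Definition smooth_compact u :=
  [/\ smooth_on Hn u, compact (hsupport u) & hsupport u `<=` Hn].

Definition laplace_beltrami f w : R :=
  let n : R := m.+1%:R in
  xlast w ^+ 2 * (\sum_(j < m.+1 | j != ord_max) partial j (partial j f) w)
  + xlast w ^+ 2 * partial ord_max (partial ord_max f) w
  + (2 - n) * xlast w * partial ord_max f w
  + (n - 1) ^+ 2 / 4 * f w.

Definition row_of_tuple (t : m.+1.-tuple (measurableTypeR R)) : 'rV[R]_m.+1 :=
  \row_(i < m.+1) tnth t i.

(* The density x_n ^ (-n) of the hyperbolic volume is put in the integrand. *)
Definition hintegrand f (t : m.+1.-tuple (measurableTypeR R)) : R :=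
  f (row_of_tuple t) * xlast (row_of_tuple t) ^- m.+1.

Definition hintegrable f : Prop :=
  (lebesgue_Rn m.+1).-integrable (row_of_tuple @^-1` Hn)
    (fun t => (hintegrand f t)%:E).

Definition hintegral f : R :=
  \int[lebesgue_Rn m.+1]_(t in row_of_tuple @^-1` Hn) hintegrand f t.

End hyperbolic_space.

Section hdist_theory.
Context {R : realType} {m : nat}.
Implicit Types (w z : 'rV[R]_m.+1).

Lemma coshN (x : R) : cosh (- x) = cosh x.
Proof. by rewrite /cosh opprK addrC. Qed.

Lemma cosh_arcosh (s : R) : 1 <= s ->
  exists2 r : R, 0 <= r & cosh r = s.
Proof.
move=> s1; pose q := Num.sqrt (s ^+ 2 - 1).
have q0 : 0 <= q by exact: sqrtr_ge0.
have qE : q ^+ 2 = s ^+ 2 - 1 by rewrite sqr_sqrtr//; nra.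
have sq0 : 0 < s + q by lra.
exists (ln (s + q)); first by rewrite ln_ge0//; lra.
rewrite /cosh expRN lnK ?posrE//.
have -> : (s + q)^-1 = s - q.
  by apply: (mulfI (lt0r_neq0 sq0)); rewrite divff ?lt0r_neq0//; nra.
by field.
Qed.

Lemma cosh_inj_ge0 (a b : R) : 0 <= a -> 0 <= b -> cosh a = cosh b -> a = b.
Proof.
move=> a0 b0; rewrite /cosh !expRN => /(congr1 (fun x => x * 2)).
rewrite !divfK ?pnatr_eq0// => E; apply: expR_inj.
have A1 : 1 <= expR a by rewrite -expR0 ler_expR.
have B1 : 1 <= expR b by rewrite -expR0 ler_expR.
have A0 : expR a != 0 by rewrite gt_eqF ?expR_gt0.
have B0 : expR b != 0 by rewrite gt_eqF ?expR_gt0.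
have : (expR a - expR b) * (expR a * expR b - 1) = 0.
  have -> : (expR a - expR b) * (expR a * expR b - 1) = expR a * expR b *
      ((expR a + (expR a)^-1) - (expR b + (expR b)^-1)).
    by field; rewrite A0 B0.
  by rewrite E subrr mulr0.
move=> /eqP; rewrite mulf_eq0 => /orP[/eqP|/eqP] H; first lra.
nra.
Qed.

Lemma hdistP w z : Hn w -> Hn z -> hdist_spec w z (hdist w z).
Proof.
rewrite /Hn /= => w0 z0; apply: getPex.
pose d := sqr_dist w z / (4 * xlast w * xlast z) + 1.
have d1 : 1 <= d.
  rewrite lerDr divr_ge0 ?sumr_ge0// => [i _|]; first exact: sqr_ge0.
  by rewrite !mulr_ge0// ltW.
have [|r r0 rE] := @cosh_arcosh (Num.sqrt d).
  by rewrite -sqrtr1 ler_wsqrtr.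
exists (2 * r); split; first by rewrite mulr_ge0.
have -> : 2 * r / 2 = r by field.
by rewrite rE sqr_sqrtr// (le_trans ler01).
Qed.

Lemma hdist_unique w z (r : R) : Hn w -> Hn z -> hdist_spec w z r ->
  r = hdist w z.
Proof.
move=> w0 z0 [r0 rE]; have [d0 dE] := hdistP w0 z0.
have c0 (x : R) : 0 <= cosh x by rewrite divr_ge0// addr_ge0// expR_ge0.
have : r / 2 = hdist w z / 2.
  apply: cosh_inj_ge0; rewrite ?divr_ge0//.
  by apply/eqP; rewrite -(@eqrXn2 _ 2)// rE dE.
lra.
Qed.

End hdist_theory.

Section poisson.
Context {R : realType}.

Definition Gamma (x : R) : R :=
  \int[lebesgue_measure]_(t in `]0, +oo[) (t `^ (x - 1) * expR (- t)).

Context {m : nat}.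
Implicit Types (w z : 'rV[R]_m.+1) (y : R) (u : 'rV[R]_m.+1 -> R).

Definition kernel_denominator y w z : R := 2 * cosh (hdist w z) - 2 * cos y.

Definition poisson_kernel y w z : R :=
  let a : R := (m.+1%:R + 1) / 2 in
  Gamma a / (pi `^ a) * (sin y / kernel_denominator y w z `^ a).

Definition poisson_integral u y w : R :=
  hintegral (fun z => poisson_kernel y w z * u z).

(* For w in H^n, (y, w) is singular exactly when y is in 2 pi Z and w in the
   support of u; the kernel is then undefined at z = w (division by zero).
   At such points the Poisson equation fails in general: the integral is
   2 pi-periodic and odd in y, hence tends to u w when y decreases to 2 pi and
   to - u w when y increases to 2 pi. *)
Definition nonsingular u y w : Prop :=
  forall z, hsupport u z -> kernel_denominator y w z != 0.

(* The existence of the derivatives is required, because derive and derive1 are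
   total operators. *)
Definition poisson_equation_at (U : R -> 'rV[R]_m.+1 -> R) y w : Prop :=
  [/\ forall j, derivable (U y) w (basis_vec j) /\
                derivable (partial j (U y)) w (basis_vec j),
      derivable (U ^~ w) y 1 /\ derivable (derive1 (U ^~ w)) y 1
    & laplace_beltrami (U y) w = - derive1n 2 (U ^~ w) y].

End poisson.

(* Main.v *)
Require Import Defs.
From mathcomp Require Import all_boot all_order all_algebra.
From mathcomp Require Import all_classical all_reals all_analysis.
From mathcomp Require Import measurable_realfun ring lra.
Import Order.TTheory GRing.Theory Num.Theory.
Import numFieldNormedType.Exports.
Local Open Scope classical_set_scope.
Local Open Scope ring_scope.
Set Implicit Arguments.
Unset Strict Implicit.
Unset Printing Implicit Defensive.

(* For w, z in H^n, 2 cosh rho(w, z) - 2 cos y equals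
     Q = 2 - 2 cos y + |w - z|^2 / (w_n z_n),
   so that the kernel is C sin y Q^(-(n+1)/2). On the compact support of the
   datum Q is bounded away from 0 near a nonsingular point, which allows two
   differentiations under the integral sign in y and in each coordinate of w;
   the equation then follows from the pointwise identity satisfied by the
   kernel.
   For the initial value, put s = 2 sin(y/2) w_n and substitute z = w + s v.
   Since 2 - 2 cos y = (2 sin(y/2))^2, all powers of s cancel and
     U(y, w) = C cos(y/2) \int (1 + |v|^2 w_n/z_n)^(-(n+1)/2)
                               (w_n/z_n)^n U0(z) dv,
   which tends to C U0(w) \int (1 + |v|^2)^(-(n+1)/2) dv by dominated
   convergence. Writing the last integrand as a Gamma integral and using
   Tonelli and the Gauss integral, the integral is
   pi^(n/2) Gamma(1/2) / Gamma((n+1)/2) = 1/C; the case n = 1 (the integral of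
   1/(1 + x^2)) gives Gamma(1/2) = sqrt pi. *)

(** * Affine changes of variable *)

(* The measure structure of a pushforward depends on the proof of measurability,
   which inference cannot find. *)
Definition pushforward_of d d' (T1 : measurableType d) (T2 : measurableType d')
    (R : realType) (m : {measure set T1 -> \bar R}) (f : T1 -> T2)
    (mf : measurable_fun setT f) : {measure set T2 -> \bar R}.
Proof. by refine (pushforward m f); exact: mf. Defined.

Section affine_change_of_variable.
Context {R : realType}.
Local Notation leb := (@lebesgue_measure R).
Local Open Scope ereal_scope.

Lemma measurable_affine (w s : R) :
  measurable_fun setT (fun x : measurableTypeR R => (w + s * x)%R : measurableTypeR R).
Proof. by apply: measurable_funD => //; exact: measurable_funM. Qed.

(** Lebesgue measure is determined by its values on the intervals []a, b]], and [s] times the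
    push-forward of [leb] under the inverse map takes the same values there. *)
Lemma lebesgue_measure_affine (w s : R) (A : set (measurableTypeR R)) :
  (0 < s)%R -> measurable A ->
  leb A = s%:E *
    leb ((fun x : measurableTypeR R => (w + s * x)%R : measurableTypeR R) @^-1` A).
Proof.
move=> s0 mA.
pose phi := (fun x : measurableTypeR R => (w + s * x)%R : measurableTypeR R).
have mphi : measurable_fun setT phi by exact: measurable_affine.
pose nu := mscale (NngNum (ltW s0)) (pushforward_of leb mphi).
transitivity (nu A); last by [].
apply: (lebesgue_measure_unique (mu := nu)) => //= _ [[a b]] _ <-.
rewrite /nu/= /mscale/= /pushforward.
have -> : (phi @^-1` `]a, b] = `](a - w) / s, (b - w) / s]%classic)%R.
  apply/seteqP; split => x /=; rewrite !in_itv/= /phi => /andP[xa xb].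
    by rewrite ltr_pdivrMr// ler_pdivlMr//; apply/andP; split; lra.
  move: xa xb; rewrite ltr_pdivrMr// ler_pdivlMr// => xa xb.
  by apply/andP; split; lra.
rewrite !lebesgue_measure_itv/= !lte_fin.
have -> : ((a - w) / s < (b - w) / s)%R = (a < b)%R.
  by rewrite ltr_pM2r ?invr_gt0// ltrD2r.
case: ifPn => _; last by rewrite mule0.
by rewrite -!EFinD -EFinM; congr EFin; field; rewrite gt_eqF.
Qed.

Lemma ge0_integral_affine (w s : R) (f : measurableTypeR R -> \bar R) : (0 < s)%R ->
  measurable_fun setT f -> (forall x, 0 <= f x) ->
  \int[leb]_x f x = s%:E * \int[leb]_x f (w + s * x)%R.
Proof.
move=> s0 mf f0.
pose phi := (fun x : measurableTypeR R => (w + s * x)%R : measurableTypeR R).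
have mphi : measurable_fun setT phi by exact: measurable_affine.
pose nu := mscale (NngNum (ltW s0)) (pushforward_of leb mphi).
rewrite (@eq_measure_integral _ _ _ _ nu); last first.
  move=> A mA _; exact: lebesgue_measure_affine.
rewrite ge0_integral_mscale//=.
by rewrite (@ge0_integral_pushforward _ _ _ _ _ _ mphi)// preimage_setT.
Qed.

Lemma integral_lebesgue_R0 (f : 0.-tuple (measurableTypeR R) -> \bar R) :
  \int[lebesgue_Rn 0]_t f t = f [tuple].
Proof.
rewrite /= integral_dirac//; first by rewrite /dirac indicE in_setT mul1e.
rewrite (_ : f = cst (f [tuple])); first exact: measurable_cst.
by apply/funext => t; rewrite (tuple0 t).
Qed.

Lemma measurable_tcons_pair n (a : measurableTypeR R) :
  measurable_fun setT (fun t : n.-tuple (measurableTypeR R) => tcons (a, t)).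
Proof. by apply: measurableT_comp; [exact: measurable_tcons|]. Qed.

(** Tonelli's theorem through the push-forward that defines [lebesgue_Rn n.+1]; inductions on the
    dimension peel off the first coordinate with it. *)
Lemma ge0_integral_lebesgue_RnS n (f : n.+1.-tuple (measurableTypeR R) -> \bar R) :
  measurable_fun setT f -> (forall x, 0 <= f x) ->
  \int[lebesgue_Rn n.+1]_t f t =
  \int[leb]_a \int[lebesgue_Rn n]_t f (tcons (a, t)).
Proof.
move=> mf f0; rewrite /= /tcons_measure.
rewrite (@ge0_integral_pushforward _ _ _ _ _ _ (@measurable_tcons R n))//.
rewrite preimage_setT fubini_tonelli1//.
  by apply: measurableT_comp => //; exact: measurable_tcons.
by move=> x; exact: f0.
Qed.

Definition affine_tuple n (w : 'I_n -> R) (s : R)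
    (t : n.-tuple (measurableTypeR R)) : n.-tuple (measurableTypeR R) :=
  [tuple (w i + s * tnth t i)%R | i < n].

Lemma measurable_affine_tuple n (w : 'I_n -> R) s :
  measurable_fun setT (affine_tuple w s).
Proof.
apply/measurable_fun_tnthP => i; rewrite /comp.
under eq_fun do rewrite tnth_mktuple.
apply: measurable_funD => //; apply: measurable_funM => //.
exact: measurable_tnth.
Qed.

(** Each coordinate contributes one factor [s], by the one-dimensional substitution. *)
Lemma ge0_integral_Rn_affine n (w : 'I_n -> R) s
    (f : n.-tuple (measurableTypeR R) -> \bar R) : (0 < s)%R ->
  measurable_fun setT f -> (forall x, 0 <= f x) ->
  \int[lebesgue_Rn n]_t f t =
  (s ^+ n)%:E * \int[lebesgue_Rn n]_t f (affine_tuple w s t).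
Proof.
move=> s0; elim: n w f => [|n IH] w f mf f0.
  rewrite expr0 mul1e; apply: eq_integral => t _; congr f.
  by apply: eq_from_tnth; case.
have mfA : measurable_fun setT (f \o affine_tuple w s).
  by apply: (measurableT_comp mf); exact: measurable_affine_tuple.
rewrite !ge0_integral_lebesgue_RnS//.
have E a t : affine_tuple w s (tcons (a, t)) =
    tcons ((w ord0 + s * a)%R, affine_tuple (fun i => w (lift ord0 i)) s t).
  apply: eq_from_tnth => i; rewrite tnth_mktuple.
  case: (unliftP ord0 i) => [j|] ->; last by rewrite !tnth0.
  by rewrite !tnthS tnth_mktuple.
under [in RHS]eq_integral do under eq_integral do rewrite E.
set g := fun a => \int[lebesgue_Rn n]_t
   f (tcons (a, affine_tuple (fun i => w (lift ord0 i)) s t)).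
have mg : measurable_fun setT g.
  apply: (@measurable_fun_fubini_tonelli_F _ _ _ _ _ (lebesgue_Rn n)
    (fun p : measurableTypeR R * n.-tuple (measurableTypeR R) =>
    f (tcons (p.1, affine_tuple (fun i => w (lift ord0 i)) s p.2)))) => //.
  apply: measurableT_comp => //; apply: measurableT_comp.
    exact: measurable_tcons.
  apply/measurable_fun_pairP; split.
    exact: measurable_fst.
  apply: (measurableT_comp (measurable_affine_tuple (fun i => w (lift ord0 i)) s)).
  exact: measurable_snd.
transitivity ((s ^+ n)%:E * \int[leb]_a g a).
  rewrite -ge0_integralZl//; last 2 first.
    by move=> x _; apply: integral_ge0.
    by rewrite lee_fin exprn_ge0// ltW.
  apply: eq_integral => a _; rewrite (IH (fun i => w (lift ord0 i)))//.
  by apply: measurableT_comp => //; exact: measurable_tcons_pair.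
rewrite (@ge0_integral_affine (w ord0) s)//; last first.
  by move=> x; apply: integral_ge0.
by rewrite muleA -EFinM -exprSr.
Qed.

End affine_change_of_variable.

(** * The normalizing constant *)

Section gamma_integral.
Context {R : realType}.
Local Notation leb := (@lebesgue_measure R).
Implicit Types a b c q : R.

Definition sqr_norm n (t : n.-tuple (measurableTypeR R)) : R :=
  \sum_(i < n) tnth t i ^+ 2.

Lemma sqr_norm_ge0 n (t : n.-tuple (measurableTypeR R)) : 0 <= sqr_norm t.
Proof. by apply: sumr_ge0 => i _; exact: sqr_ge0. Qed.

Lemma sqr_norm_tcons n (x : measurableTypeR R) (t : n.-tuple (measurableTypeR R)) :
  sqr_norm (tcons (x, t)) = x ^+ 2 + sqr_norm t.
Proof.
rewrite /sqr_norm big_ord_recl tnth0; congr (_ + _).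
by apply: eq_bigr => i _; rewrite tnthS.
Qed.

Lemma measurable_sqr_norm n : measurable_fun setT (@sqr_norm n).
Proof.
apply: measurable_sum => i; apply: measurable_funX; exact: measurable_tnth.
Qed.

Lemma integral_expR_sqr b : 0 < b ->
  (\int[leb]_x (expR (- (b * x ^+ 2)))%:E = (Num.sqrt pi / Num.sqrt b)%:E)%E.
Proof.
move=> b0; have sb : 0 < Num.sqrt b by rewrite sqrtr_gt0.
have := @integralT_gauss R.
rewrite (@ge0_integral_affine R 0 (Num.sqrt b))//; last 2 first.
  by apply/measurable_EFinP; exact: measurable_gauss_fun.
  by move=> x; rewrite lee_fin gauss_fun_ge0.
under eq_integral => x _ do rewrite /gauss_fun add0r exprMn sqr_sqrtr ?ltW//.
(* The substitution has left [Num.sqrt b * I = Num.sqrt pi] in the extended reals; [I] has to be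
   finite before one divides. *)
set I := (\int[_]_x _)%E; have : (0 <= I)%E.
  by apply: integral_ge0 => x _; rewrite lee_fin expR_ge0.
case: I => [r| |] // _; last by rewrite gt0_muley.
rewrite -EFinM => -[<-]; congr EFin; rewrite mulrAC divff ?mul1r//.
by rewrite gt_eqF.
Qed.

Lemma integral_Rn_expR_sqr n b : 0 < b ->
  (\int[lebesgue_Rn n]_v (expR (- (b * sqr_norm v)))%:E =
  ((Num.sqrt pi / Num.sqrt b) ^+ n)%:E)%E.
Proof.
move=> b0.
have mexp k : measurable_fun [set: k.-tuple (measurableTypeR R)]
    (fun v => (expR (- (b * sqr_norm v)))%:E).
  apply/measurable_EFinP; apply: measurableT_comp => //.
  apply: measurableT_comp => //; apply: measurable_funM => //.
  exact: measurable_sqr_norm.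
elim: n => [|n IH].
  by rewrite integral_lebesgue_R0 /sqr_norm big_ord0 mulr0 oppr0 expR0 expr0.
rewrite ge0_integral_lebesgue_RnS//.
under eq_integral => x _.
  under eq_integral => t _ do
    rewrite sqr_norm_tcons mulrDr opprD expRD EFinM.
  rewrite ge0_integralZl//; last exact: mexp.
  rewrite IH.
  over.
rewrite ge0_integralZr//; last first.
  apply/measurable_EFinP; apply: measurableT_comp => //.
  by apply: measurableT_comp => //; exact: measurable_funM.
by rewrite integral_expR_sqr// -EFinM -exprS.
Qed.

(** The integrand of Euler's integral extended by zero, so that the affine substitution on the whole
    line applies. *)
Definition gamma_fun a : R -> R :=
  (fun t => t `^ (a - 1) * expR (- t)) \_ `]0, +oo[.

Lemma gamma_fun_ge0 a t : 0 <= gamma_fun a t.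
Proof. by apply: restrict_ge0 => x _; rewrite mulr_ge0 ?powR_ge0 ?expR_ge0. Qed.

Lemma gamma_fun_gt0E a t : 0 < t -> gamma_fun a t = t `^ (a - 1) * expR (- t).
Proof. by move=> t0; rewrite /gamma_fun patchE mem_set//= in_itv/= t0. Qed.

Lemma gamma_fun_le0E a t : t <= 0 -> gamma_fun a t = 0.
Proof.
move=> t0; rewrite /gamma_fun patchE memNset//= in_itv/= andbT.
by apply/negP; rewrite -leNgt.
Qed.

Lemma measurable_gamma_fun a : measurable_fun setT (gamma_fun a).
Proof.
apply/measurable_restrict => //; apply: measurable_funTS.
apply: measurable_funM; first exact: measurable_powR.
by apply: measurableT_comp => //; exact: measurableT_comp.
Qed.

(** Euler's integral as an extended real: Tonelli applies before its finiteness is known, whereas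
    [Gamma] would send an infinite value to 0. *)
Definition GammaE a : \bar R := (\int[leb]_t (gamma_fun a t)%:E)%E.

Lemma GammaE_ge0 a : (0 <= GammaE a)%E.
Proof. by apply: integral_ge0 => x _; rewrite lee_fin gamma_fun_ge0. Qed.

Lemma GammaEE a : Gamma a = fine (GammaE a).
Proof.
rewrite /Gamma Rintegral_mkcond /Rintegral /GammaE /gamma_fun; congr fine.
Qed.

(** Substituting (1 + q) t for t in Euler's integral writes a power of 1 + q as a superposition of
    exponentials in q. *)
Lemma integral_gamma_fun_expR a q : 0 <= q ->
  (\int[leb]_t (gamma_fun a t * expR (- (t * q)))%:E =
   ((1 + q) `^ (- a))%:E * GammaE a)%E.
Proof.
move=> q0; have c0 : 0 < 1 + q by lra.
rewrite /GammaE (@ge0_integral_affine R 0 (1 + q) (fun t => (gamma_fun a t)%:E))//;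
  last 2 first.
  by apply/measurable_EFinP; exact: measurable_gamma_fun.
  by move=> x; rewrite lee_fin gamma_fun_ge0.
under [in RHS]eq_integral => t _.
  have -> : gamma_fun a (0 + (1 + q) * t) =
      (1 + q) `^ (a - 1) * (gamma_fun a t * expR (- (t * q))).
    have [t0|t0] := ltP 0 t.
      rewrite add0r !gamma_fun_gt0E ?mulr_gt0// powRM ?ltW//.
      by rewrite !mulrA -[RHS]mulrA -expRD; congr (_ * expR _); ring.
    rewrite add0r !gamma_fun_le0E ?mul0r ?mulr0//.
    by rewrite pmulr_rle0.
  rewrite EFinM.
  over.
rewrite ge0_integralZl//; last 3 first.
- apply/measurable_EFinP; apply: measurable_funM; first exact: measurable_gamma_fun.
  apply: measurableT_comp => //; apply: measurableT_comp => //.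
  exact: measurable_funM.
- by move=> x _; rewrite lee_fin mulr_ge0 ?gamma_fun_ge0 ?expR_ge0.
- by rewrite lee_fin powR_ge0.
rewrite !muleA -!EFinM powRN powRB; last by rewrite (gt_eqF c0) implybT.
rewrite powRr1 ?ltW// mulrACA divff ?mulr1 ?gt_eqF//.
by rewrite mulVf ?mul1e// gt_eqF// powR_gt0.
Qed.

(** Once the power is a superposition of exponentials, Tonelli puts a Gaussian integral inside. Its
    value (sqrt pi)^n t^(-n/2) shifts the exponent from a to a - n/2. The identity holds in
    [0, +oo], so convergence can be read off from it. *)
Lemma integral_Rn_gamma_tonelli n a :
  (\int[lebesgue_Rn n]_v (((1 + sqr_norm v) `^ (- a))%:E * GammaE a) =
   (Num.sqrt pi ^+ n)%:E * GammaE (a - n%:R / 2))%E.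
Proof.
under eq_integral => v _ do
  rewrite -(integral_gamma_fun_expR _ (sqr_norm_ge0 v)).
pose F (p : measurableTypeR R * n.-tuple (measurableTypeR R)) :=
  (gamma_fun a p.1 * expR (- (p.1 * sqr_norm p.2)))%:E.
have mF : measurable_fun setT F.
  apply/measurable_EFinP; apply: measurable_funM.
    by apply: measurableT_comp => //; exact: measurable_gamma_fun.
  apply: measurableT_comp => //; apply: measurableT_comp => //.
  apply: measurable_funM => //.
  apply: measurableT_comp => //; exact: measurable_sqr_norm.
have F0 p : (0 <= F p)%E.
  by rewrite lee_fin mulr_ge0 ?gamma_fun_ge0 ?expR_ge0.
rewrite -(@fubini_tonelli _ _ _ _ _ leb (lebesgue_Rn n) F mF F0) /F /=.
rewrite -ge0_integralZl//; last 2 first.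
- by apply/measurable_EFinP; exact: measurable_gamma_fun.
- by move=> x _; rewrite lee_fin gamma_fun_ge0.
apply: eq_integral => t _.
under eq_integral => v _ do rewrite EFinM.
rewrite ge0_integralZl//; last 2 first.
- apply/measurable_EFinP; apply: measurableT_comp => //.
  apply: measurableT_comp => //; apply: measurable_funM => //.
  exact: measurable_sqr_norm.
- by rewrite lee_fin gamma_fun_ge0.
(* For t <= 0 the Gaussian integral may be infinite, but it is multiplied by 0, and 0 times +oo is
   0. *)
have [t0|t0] := leP t 0; first by rewrite !gamma_fun_le0E// mul0e mule0.
rewrite integral_Rn_expR_sqr// -!EFinM !gamma_fun_gt0E//; congr EFin.
have -> : t `^ (a - n%:R / 2 - 1) = t `^ (a - 1) / Num.sqrt t ^+ n.
  rewrite (_ : a - n%:R / 2 - 1 = (a - 1) - 2^-1 * n%:R); last by field.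
  rewrite powRB; last by rewrite (gt_eqF t0) implybT.
  by rewrite powRrM powR12_sqrt ?ltW// powR_mulrn// sqrtr_ge0.
by rewrite expr_div_n; ring.
Qed.

End gamma_integral.

(** * Gamma at 1/2 and the integral of the Poisson profile *)

Section poisson_constant.
Context {R : realType}.
Local Notation leb := (@lebesgue_measure R).
Local Open Scope ereal_scope.

Lemma integral_EFin_patch d (T : measurableType d)
    (mu : {measure set T -> \bar R}) (D : set T) (f : T -> R) :
  \int[mu]_x ((f \_ D) x)%:E = \int[mu]_(x in D) (f x)%:E.
Proof.
rewrite [RHS]integral_mkcond; apply: eq_integral => x _.
by rewrite !patchE; case: ifPn.
Qed.

(** The integrand is the exponential density of rate 1, except at the endpoint 0, a null set. *)
Lemma GammaE1 : GammaE (1 : R) = 1.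
Proof.
rewrite -[RHS](@integral_exponential_pdf R 1)//.
rewrite /GammaE /gamma_fun /exponential_pdf !integral_EFin_patch.
rewrite -integral_itv_obnd_cbnd; last first.
  apply/measurable_EFinP; apply: measurable_funTS; apply: measurable_funM => //.
  by apply: measurableT_comp => //; exact: measurable_funM.
apply: eq_integral => x _.
by rewrite subrr powRr0 !mul1r mulN1r.
Qed.

Lemma integralT_oneDsqr : \int[leb]_x (oneDsqr x)^-1%:E = (@pi R)%:E.
Proof.
rewrite (ge0_symfun_integralT (f := fun x => (oneDsqr x)^-1%R)).
- by rewrite -set_itvcy integral0y_oneDsqr -EFinM; congr EFin; field.
- by move=> x; rewrite invr_ge0 (le_trans ler01).
- exact: continuous_oneDsqrV.
- by move=> x /=; rewrite /oneDsqr sqrrN.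
Qed.

(** For a = 1 and n = 1 the left side of [integral_Rn_gamma_tonelli] is the integral of 1/(1 + x^2),
    that is pi, and the right side is sqrt pi times the value sought. *)
Lemma GammaE_half : GammaE (2^-1 : R) = (Num.sqrt pi)%:E.
Proof.
have := @integral_Rn_gamma_tonelli R 1 1.
rewrite GammaE1 expr1 (_ : 1 - 1%:R / 2 = 2^-1 :> R)%R; last by field.
rewrite ge0_integral_lebesgue_RnS//; last 2 first.
  rewrite /=.
  under eq_fun do rewrite mule1.
  apply/measurable_EFinP/(measurableT_comp (@measurable_powR R _)).
  by apply: measurable_funD => //; exact: measurable_sqr_norm.
  by move=> x; rewrite mule1 lee_fin powR_ge0.
under eq_integral => x _.
  rewrite integral_lebesgue_R0 mule1 sqr_norm_tcons.
  rewrite /sqr_norm big_ord0 addr0 powR_inv1; last by rewrite addr_ge0// sqr_ge0.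
  rewrite -/(oneDsqr x).
  over.
rewrite integralT_oneDsqr.
have p0 : (0 < Num.sqrt (@pi R))%R by rewrite sqrtr_gt0 pi_gt0.
have := GammaE_ge0 (2^-1 : R); case: GammaE => [r||]// r0; last first.
  by rewrite gt0_muley.
rewrite -EFinM => -[E]; congr EFin; apply: (mulfI (lt0r_neq0 p0)).
by rewrite -E -expr2 sqr_sqrtr// pi_ge0.
Qed.

(** For this [a] the shifted exponent a - n/2 is 1/2 in every dimension, and (sqrt pi)^(n+1) is
    pi^a. *)
Lemma GammaE_integral_poisson n : let a : R := ((n%:R + 1) / 2)%R in
  GammaE a * \int[lebesgue_Rn n]_v ((1 + sqr_norm v) `^ (- a))%:E = (pi `^ a)%:E.
Proof.
move=> a; rewrite muleC -ge0_integralZr//; last 3 first.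
  apply/measurable_EFinP/(measurableT_comp (@measurable_powR R _)).
  by apply: measurable_funD => //; exact: measurable_sqr_norm.
  by move=> x _; rewrite lee_fin powR_ge0.
  exact: GammaE_ge0.
rewrite integral_Rn_gamma_tonelli (_ : a - n%:R / 2 = 2^-1)%R; last first.
  by rewrite /a; field.
rewrite GammaE_half -EFinM -exprSr; congr EFin.
rewrite -powR12_sqrt ?pi_ge0// -powR_mulrn ?powR_ge0// -powRrM.
by congr powR; rewrite /a -natr1; field.
Qed.

(** Two elements of [0, +oo] whose product is finite and positive are both finite and positive, so
    convergence comes together with the value. *)
Lemma Gamma_integral_poisson n : let a : R := ((n%:R + 1) / 2)%R in
  (0 < Gamma a)%R /\
  \int[lebesgue_Rn n]_v ((1 + sqr_norm v) `^ (- a))%:E = (pi `^ a / Gamma a)%:E.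
Proof.
move=> a; have := GammaE_integral_poisson n; rewrite /= -/a GammaEE.
have p0 : (0 < (@pi R) `^ a)%R by rewrite powR_gt0// pi_gt0.
have I0 : 0 <= \int[lebesgue_Rn n]_v ((1 + sqr_norm v) `^ (- a))%:E.
  by apply: integral_ge0 => v _; rewrite lee_fin powR_ge0.
move: I0 (GammaE_ge0 a).
set I := \int[_]_v _; case: GammaE => [g||]//; case: I => [r||]//.
- rewrite !lee_fin -EFinM => r0 g0 [E] /=.

  rewrite /=.
  have g_gt0 : (0 < g)%R.
    by rewrite lt_def g0 andbT; apply: contraTneq p0 => g00; rewrite -E g00 mul0r ltxx.
  by split=> //; rewrite -E mulrAC divff ?mul1r// gt_eqF.
- move=> _; rewrite lee_fin le_eqVlt => /predU1P[<-|g0].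
    by rewrite mul0e => -[E]; rewrite -E ltxx in p0.
  by rewrite gt0_muley.
- rewrite lee_fin le_eqVlt => /predU1P[<-|r0] _.
    by rewrite mule0 => -[E]; rewrite -E ltxx in p0.
  by rewrite gt0_mulye.
Qed.

End poisson_constant.

(** * Second derivatives of integrals *)

Section bounded_on.
Context {R : realType} {X : Type}.
Implicit Types (A : set X) (f g : X -> R).

(** [X] carries no structure: its elements are parameters, points of integration, or pairs of both,
    which gives bounds uniform in the parameter. *)
Definition bounded_on A f := exists B, forall x, A x -> `|f x| <= B.

Lemma bounded_on_cst A k : bounded_on A (fun=> k).
Proof. by exists `|k|. Qed.

Lemma bounded_onN A f : bounded_on A f -> bounded_on A (fun x => - f x).
Proof. by move=> [B fB]; exists B => x Ax; rewrite normrN fB. Qed.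

Lemma bounded_onD A f g : bounded_on A f -> bounded_on A g ->
  bounded_on A (fun x => f x + g x).
Proof.
move=> [B fB] [C gC]; exists (B + C) => x Ax.
by rewrite (le_trans (ler_normD _ _))// lerD ?fB ?gC.
Qed.

Lemma bounded_onB A f g : bounded_on A f -> bounded_on A g ->
  bounded_on A (fun x => f x - g x).
Proof. by move=> bf bg; apply: bounded_onD => //; exact: bounded_onN. Qed.

Lemma bounded_onM A f g : bounded_on A f -> bounded_on A g ->
  bounded_on A (fun x => f x * g x).
Proof.
move=> [B fB] [C gC]; exists (B * C) => x Ax.
by rewrite normrM ler_pM ?fB ?gC.
Qed.

Lemma bounded_onX A f n : bounded_on A f -> bounded_on A (fun x => f x ^+ n).
Proof.
move=> [B fB]; exists (B ^+ n) => x Ax.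
by rewrite normrX lerXn2r ?nnegrE ?fB// (le_trans _ (fB _ Ax)).
Qed.

Lemma powR_le_bound (e x c : R) : 0 < e -> e <= x -> c <= 0 -> x `^ c <= e `^ c.
Proof.
move=> e0 ex c0; have x0 := lt_le_trans e0 ex.
rewrite -(opprK c) (powRN x (- c)) (powRN e (- c)) lef_pV2 ?posrE ?powR_gt0//.
by rewrite ge0_ler_powR ?nnegrE ?oppr_ge0 ?(ltW e0) ?(ltW x0).
Qed.

Lemma bounded_on_powR A f e c : 0 < e -> c <= 0 -> (forall x, A x -> e <= f x) ->
  bounded_on A (fun x => f x `^ c).
Proof.
move=> e0 c0 ef; exists (e `^ c) => x Ax.
by rewrite ger0_norm ?powR_ge0// powR_le_bound ?ef.
Qed.

Lemma bounded_onV A f e : 0 < e -> (forall x, A x -> e <= f x) ->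
  bounded_on A (fun x => (f x)^-1).
Proof.
move=> e0 ef; exists e^-1 => x /ef ex; have f0 := lt_le_trans e0 ex.
by rewrite ger0_norm ?invr_ge0 ?(ltW f0)// lef_pV2.
Qed.

End bounded_on.

Lemma bounded_on_comp (R : realType) (X Y : Type) (A : set X) (B : set Y)
    (h : X -> Y) (f : Y -> R) :
  (forall x, A x -> B (h x)) -> bounded_on B f -> bounded_on A (f \o h).
Proof. by move=> hAB [C fC]; exists C => x Ax; exact/fC/hAB. Qed.

Section second_derivative.
Context {R : realType}.

Lemma near_itv (x d : R) (P : R -> Prop) : 0 < d ->
  (forall t, `|t - x| < d -> P t) -> \forall t \near x, P t.
Proof.
move=> d0 H; near=> t; apply: H; rewrite distrC.
by near: t; exact: cvgr_dist_lt.
Unshelve. all: by end_near. Qed.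

(** [derive1 f] agrees with [F1] on a whole neighbourhood of [x], hence inherits the derivative of
    [F1] at [x]. *)
Lemma second_derive (f F1 : R -> R) (x l : R) :
  (\forall t \near x, is_derive (t : R) (1 : R) f (F1 t)) -> is_derive x 1 F1 l ->
  [/\ derivable f x 1, derivable (derive1 f) x 1, derive1 f x = F1 x
    & derive1 (derive1 f) x = l].
Proof.
move=> nf dF1; have dfx := nbhs_singleton nf.
have E : {near x, derive1 f =1 F1}.
  near=> t; rewrite derive1E.
  suff /@derive_val : is_derive t 1 f (F1 t) by [].
  by near: t.
split.
- exact: ex_derive.
- by apply: (near_eq_derivable _ (f := F1)) => //; near=> t; apply/esym; near: t.
- by rewrite derive1E; exact: derive_val.
- rewrite derive1E (near_eq_derive _ E)//; exact: derive_val.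
Unshelve. all: by end_near. Qed.

(** Along the line w + s e the difference quotients of [f] in the direction [e] are those of the
    one-variable function [g], which reduces the claim to [second_derive] at 0. *)
Lemma second_derive_dir (V : normedModType R) (f : V -> R) (w e : V)
    (F1 : R -> R) (l : R) :
  (\forall t \near (0 : R), is_derive (t : R) (1 : R) (fun s : R => f (s *: e + w)) (F1 t)) ->
  is_derive (0 : R) (1 : R) F1 l ->
  [/\ derivable f w e, derivable ('D_e f) w e, 'D_e f w = F1 0
    & 'D_e ('D_e f) w = l].
Proof.
set g := fun s : R => f (s *: e + w).
have quotE s : (fun h => h^-1 *: ((f \o shift (s *: e + w)) (h *: e) - f (s *: e + w)))
     = (fun h => h^-1 *: ((g \o shift s) (h *: (1 : R)) - g s)).
  apply/funext => h /=; congr (_ *: (_ - _)).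
  by rewrite /g addrA -scalerDl /GRing.scale/= mulr1.
have dE s : derivable f (s *: e + w) e = derivable g s 1.
  by rewrite /derivable quotE.
have DE s : 'D_e f (s *: e + w) = 'D_1 g s by rewrite /derive quotE.
move=> nf dF1; have [H1 H2 H3 H4] := second_derive nf dF1.
have w0 : w = 0 *: e + w by rewrite scale0r add0r.
have quot2 : (fun h => h^-1 *: (('D_e f \o shift w) (h *: e) - 'D_e f w))
   = (fun h => h^-1 *: ((derive1 g \o shift 0) (h *: (1 : R)) - derive1 g 0)).
  apply/funext => h /=; rewrite !derive1E -!DE scale0r add0r addr0.
  by rewrite /GRing.scale/= mulr1.
split.
- by rewrite w0 dE.
- by rewrite /derivable quot2; exact: H2.
- by rewrite w0 DE -derive1E.
- by rewrite {1}/derive quot2 -[RHS]H4 [RHS]derive1E.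
Qed.

End second_derivative.

(** * Differentiation under the integral sign *)

Section differentiation_power.
Context {R : realType} d {T : measurableType d} (mu : {measure set T -> \bar R}).
Variables (D : set T) (mD : measurable D) (phi : T -> R).
Hypothesis iphi : mu.-integrable D (EFin \o phi).

Lemma integrable_boundedM (g : T -> R) : measurable_fun D g ->
  bounded_on D g -> mu.-integrable D (fun z => (g z * phi z)%:E).
Proof.
move=> mg [B gB].
have mphi : measurable_fun D phi by have /measurable_int/measurable_EFinP := iphi.
apply: (@le_integrable _ _ _ mu D mD _ (fun z => (B * phi z)%:E)) => //.
- by apply/measurable_EFinP; exact: measurable_funM.
- move=> z Dz; rewrite lee_fin !normrM ler_wpM2r//.
  by rewrite (le_trans (gB _ Dz))// ler_norm.
- by under eq_fun do rewrite EFinM; exact: integrableZl.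
Qed.

(** The dominating function is [|C * phi|], where [C] bounds [g1] uniformly in the parameter; the
    bound on [g] makes each integrand integrable. *)
Lemma is_derive_integral (g g1 : R -> T -> R) (x0 r : R) :
  (forall t, `|t - x0| < r -> measurable_fun D (g t)) ->
  (forall t z, `|t - x0| < r -> D z -> is_derive t 1 (g ^~ z) (g1 t z)) ->
  bounded_on [set p | `|p.1 - x0| < r /\ D p.2] (fun p => g p.1 p.2) ->
  bounded_on [set p | `|p.1 - x0| < r /\ D p.2] (fun p => g1 p.1 p.2) ->
  forall t, `|t - x0| < r ->
  is_derive t 1 (fun t => \int[mu]_(z in D) (g t z * phi z))
    (\int[mu]_(z in D) (g1 t z * phi z)).
Proof.
move=> mg dg [B gB] [C g1C] t tr.
have itvE s : (s \in `]x0 - r, x0 + r[) = (`|s - x0| < r).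
  by rewrite in_itv/= ltr_norml ltrBrDl [(s - x0 < r)]ltrBlDl.
have It : [set` `]x0 - r, x0 + r[] t by rewrite /= itvE.
have iF x : [set` `]x0 - r, x0 + r[] x ->
    mu.-integrable D (EFin \o (fun z => g x z * phi z)).
  rewrite /= itvE => xr; apply: integrable_boundedM; first exact: mg.
  by exists B => z Dz; exact: (gB (x, z)).
have dF x z : [set` `]x0 - r, x0 + r[] x -> D z ->
    is_derive x 1 (fun x => g x z * phi z) (g1 x z * phi z).
  rewrite /= itvE => xr Dz; have dgx := dg _ _ xr Dz.
  by apply: is_derive_eq; rewrite scaler0 add0r /GRing.scale/= mulrC.
have d1E x z : [set` `]x0 - r, x0 + r[] x -> D z ->
    partial1of2 (fun x z => g x z * phi z) x z = g1 x z * phi z.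
  move=> Ix Dz; rewrite /partial1of2 derive1E.
  by have H := dF _ _ Ix Dz; rewrite derive_val.
have intG : mu.-integrable D (EFin \o (fun z => `|C * phi z|)).
  rewrite (_ : _ \o _ = (fun z => `|(C * phi z)%:E|%E))//.
  apply: integrable_abse.
  by under eq_fun do rewrite EFinM; exact: integrableZl.
have derF x z : [set` `]x0 - r, x0 + r[] x -> D z ->
    derivable ((fun x z => g x z * phi z)^~ z) x 1.
  by move=> Ix Dz; have H := dF _ _ Ix Dz; exact: ex_derive.
have Gub x z : [set` `]x0 - r, x0 + r[] x -> D z ->
    `|partial1of2 (fun x z => g x z * phi z) x z| <= `|C * phi z|.
  move=> Ix Dz; rewrite d1E// !normrM ler_wpM2r//.
  apply: le_trans (ler_norm _); apply: (g1C (x, z)); split => //=.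
  by rewrite -itvE.
have G0 (z : T) : 0 <= `|C * phi z| by [].
apply: DeriveDef.
  exact: (derivable_under_integral mD It iF derF G0 intG Gub).
rewrite -derive1E (differentiation_under_integral mD It iF derF G0 intG Gub).
by apply: eq_Rintegral => z /set_mem Dz; rewrite d1E.
Qed.

End differentiation_power.

(** Mean value theorem between [x] and [t], in whichever order they come. *)
Lemma derive_bound_lipschitz (R : realType) (f f1 : R -> R) (x r B : R) :
  (forall t, `|t - x| < r -> is_derive t 1 f (f1 t)) ->
  (forall t, `|t - x| < r -> `|f1 t| <= B) ->
  forall t, `|t - x| < r -> `|f t - f x| <= B * `|t - x|.
Proof.
move=> df f1B t tr.
have r0 : 0 < r by exact: le_lt_trans tr.
have sub u v s : `|u - x| < r -> `|v - x| < r -> s \in `[u, v] -> `|s - x| < r.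
  rewrite in_itv/= !ltr_norml => /andP[u1 u2] /andP[v1 v2] /andP[us sv].
  by apply/andP; split; lra.
have key u v : `|u - x| < r -> `|v - x| < r -> u <= v ->
    `|f v - f u| <= B * `|v - u|.
  move=> ur vr uv.
  have dfI s : s \in `]u, v[ -> is_derive s 1 f (f1 s).
    by move=> sI; apply/df/(sub u v) => //; exact: subset_itv_oo_cc.
  have cf : {within `[u, v], continuous f}.
    apply: derivable_within_continuous => s sI.
    by have H := df _ (sub _ _ _ ur vr sI); exact: ex_derive.
  have [s sI ->] := MVT_segment uv dfI cf.
  by rewrite normrM ler_wpM2r// f1B// (sub u v).
have xr : `|x - x| < r by rewrite subrr normr0.
have [xt|/ltW tx] := leP x t; first exact: key.
by rewrite distrC (distrC t); exact: key.
Qed.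

Section second_derivative_integral_powR.
Context {R : realType} d {T : measurableType d} (mu : {measure set T -> \bar R}).
Variables (D : set T) (mD : measurable D) (phi : T -> R).
Hypothesis iphi : mu.-integrable D (EFin \o phi).
Variables (c x r e : R) (s s1 s2 : R -> R) (Q Q1 Q2 : R -> T -> R).
Hypotheses (r0 : 0 < r) (e0 : 0 < e) (c0 : c <= 0).
Let N : set R := [set t | `|t - x| < r].
Hypotheses (ds : forall t, N t -> is_derive t 1 s (s1 t))
  (ds1 : forall t, N t -> is_derive t 1 s1 (s2 t)).
Hypotheses (bs : bounded_on N s) (bs1 : bounded_on N s1) (bs2 : bounded_on N s2).
Hypotheses (mQ : forall t, N t -> measurable_fun D (Q t))
  (mQ1 : forall t, N t -> measurable_fun D (Q1 t))
  (mQ2 : forall t, N t -> measurable_fun D (Q2 t)).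
Hypotheses (dQ : forall t z, N t -> D z -> is_derive t 1 (Q ^~ z) (Q1 t z))
  (dQ1 : forall t z, N t -> D z -> is_derive t 1 (Q1 ^~ z) (Q2 t z)).
Let ND : set (R * T) := [set p | N p.1 /\ D p.2].
Hypotheses (bQ1 : bounded_on ND (fun p => Q1 p.1 p.2))
  (bQ2 : bounded_on ND (fun p => Q2 p.1 p.2)).
Hypothesis Qe : forall z, D z -> e <= Q x z.

(** The common shape of the kernel as a function of y or of one coordinate of w, with [c] later
    equal to -(n+1)/2. The product and chain rules give [spow1] and [spow2]. *)
Definition spow (t : R) (z : T) : R := s t * Q t z `^ c.
Definition spow1 (t : R) (z : T) : R :=
  s1 t * Q t z `^ c + s t * (c * Q t z `^ (c - 1) * Q1 t z).
Definition spow2 (t : R) (z : T) : R :=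
  s2 t * Q t z `^ c + 2 * s1 t * (c * Q t z `^ (c - 1) * Q1 t z) +
  s t * (c * ((c - 1) * Q t z `^ (c - 1 - 1) * Q1 t z ^+ 2 +
              Q t z `^ (c - 1) * Q2 t z)).

(** [Q] is bounded below at the parameter [x] only. The bound is first spread to nearby parameters;
    then the powers of [Q] with nonpositive exponent are bounded and [is_derive_integral] applies
    twice. *)
Lemma integral_spow_second_derive :
  [/\ \forall t \near x, is_derive (t : R) (1 : R)
        (fun t => \int[mu]_(z in D) (spow t z * phi z))
        (\int[mu]_(z in D) (spow1 t z * phi z)),
      is_derive x 1 (fun t => \int[mu]_(z in D) (spow1 t z * phi z))
        (\int[mu]_(z in D) (spow2 x z * phi z)),
      mu.-integrable D (fun z => (spow x z * phi z)%:E),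
      mu.-integrable D (fun z => (spow1 x z * phi z)%:E)
    & mu.-integrable D (fun z => (spow2 x z * phi z)%:E)].
Proof.
have [B Q1B] := bQ1.
(* [B] bounds the slope of [Q] in t, so within this radius [Q] drops by at most e/2 and stays above
   e/2; the 1 keeps the divisor positive. *)
pose r' := Num.min r (e / 2 / (`|B| + 1)).
have B1 : 0 < `|B| + 1 by rewrite ltr_wpDl.
have r'0 : 0 < r' by rewrite lt_min r0/= !divr_gt0.
pose N' : set R := [set t | `|t - x| < r'].
have N'N t : N' t -> N t by rewrite /N' /N/= lt_min => /andP[].
have Nx : N' x by rewrite /N'/= subrr normr0.
have QE t z : N' t -> D z -> e / 2 <= Q t z.
  move=> N't Dz; have Nt := N'N _ N't.
  have := @derive_bound_lipschitz R (Q ^~ z) (Q1 ^~ z) x r B.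
  have /[swap] /[apply] : forall t, `|t - x| < r -> is_derive t 1 (Q^~ z) (Q1 t z).
    by move=> u Nu; exact: dQ.
  have /[swap] /[apply] : forall t, `|t - x| < r -> `|Q1 t z| <= B.
    by move=> u Nu; exact: (Q1B (u, z)).
  move=> /(_ _ Nt); rewrite ler_norml => /andP[+ _] /=.
  have : B * `|t - x| <= e / 2.
    apply: (@le_trans _ _ ((`|B| + 1) * `|t - x|)).
      by rewrite ler_wpM2r// (le_trans (ler_norm _))// lerDl.
    rewrite -ler_pdivlMl// mulrC ltW//.
    by move: N't; rewrite /N'/= lt_min => /andP[].
  by have := Qe Dz; lra.
have e20 : 0 < e / 2 by rewrite divr_gt0.
pose ND' : set (R * T) := [set p | N' p.1 /\ D p.2].
have bN f : bounded_on N f -> bounded_on ND' (fun p => f p.1).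
  by move=> bf; apply: (bounded_on_comp (h := fst) _ bf) => -[t z] [/= /N'N].
have bND f : bounded_on ND f -> bounded_on ND' f.
  by move=> bf; apply: (bounded_on_comp (h := id) _ bf) => -[t z] [/= /N'N].
have bp k : k <= 0 -> bounded_on ND' (fun p => Q p.1 p.2 `^ k).
  by move=> k0; apply: (bounded_on_powR e20 k0) => -[t z] [/= ? ?]; exact: QE.
have c10 : c - 1 <= 0 by have := c0; lra.
have c20 : c - 1 - 1 <= 0 by lra.
have b0 : bounded_on ND' (fun p => spow p.1 p.2).
  by apply: bounded_onM; [exact: bN|exact: bp].
have b1 : bounded_on ND' (fun p => spow1 p.1 p.2).
  apply: bounded_onD; first by apply: bounded_onM; [exact: bN|exact: bp].
  apply: bounded_onM; first exact: bN.
  apply: bounded_onM; last exact: bND.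
  by apply: bounded_onM; [exact: bounded_on_cst|exact: bp].
have b2 : bounded_on ND' (fun p => spow2 p.1 p.2).
  apply: bounded_onD; first apply: bounded_onD.
  - by apply: bounded_onM; [exact: bN|exact: bp].
  - apply: bounded_onM.
      by apply: bounded_onM; [exact: bounded_on_cst|exact: bN].
    apply: bounded_onM; last exact: bND.
    by apply: bounded_onM; [exact: bounded_on_cst|exact: bp].
  - apply: bounded_onM; first exact: bN.
    apply: bounded_onM; first exact: bounded_on_cst.
    apply: bounded_onD; apply: bounded_onM.
    + by apply: bounded_onM; [exact: bounded_on_cst|exact: bp].
    + by apply: bounded_onX; exact: bND.
    + exact: bp.
    + exact: bND.
have mp t k : N' t -> measurable_fun D (fun z => Q t z `^ k).
  move=> N't; apply: (measurableT_comp (f := fun y : R => y `^ k)).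
    exact: measurable_powR.
  exact/mQ/N'N.
have m0 t : N' t -> measurable_fun D (spow t).
  by move=> N't; apply: measurable_funM => //; exact: mp.
have m1 t : N' t -> measurable_fun D (spow1 t).
  move=> N't; apply: measurable_funD.
    by apply: measurable_funM => //; exact: mp.
  apply: measurable_funM => //; apply: measurable_funM; last exact/mQ1/N'N.
  by apply: measurable_funM => //; exact: mp.
have m2 t : N' t -> measurable_fun D (spow2 t).
  move=> N't; apply: measurable_funD; first apply: measurable_funD.
  - by apply: measurable_funM => //; exact: mp.
  - apply: measurable_funM => //; apply: measurable_funM; last exact/mQ1/N'N.
    by apply: measurable_funM => //; exact: mp.
  - apply: measurable_funM => //; apply: measurable_funM => //.
    apply: measurable_funD; apply: measurable_funM.
    + by apply: measurable_funM => //; exact: mp.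
    + by apply: measurable_funX; exact/mQ1/N'N.
    + exact: mp.
    + exact/mQ2/N'N.
have dp k t z : N' t -> D z ->
    is_derive t 1 (fun t => Q t z `^ k) (k * Q t z `^ (k - 1) * Q1 t z).
  move=> N't Dz; have dQt := dQ (N'N _ N't) Dz.
  have Q0 : 0 < Q t z by exact: lt_le_trans (QE _ _ N't Dz).
  have dpow := is_derive1_powR k Q0.
  exact: (is_derive1_comp (f := fun y => y `^ k) (g := Q ^~ z)).
have d0 t z : N' t -> D z -> is_derive t 1 (spow ^~ z) (spow1 t z).
  move=> N't Dz; have dst := ds (N'N _ N't); have dpt := dp c _ _ N't Dz.
  apply: is_derive_eq.
  by rewrite /spow1 /GRing.scale/=; ring.
have d1 t z : N' t -> D z -> is_derive t 1 (spow1 ^~ z) (spow2 t z).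
  move=> N't Dz; have dst := ds (N'N _ N't); have dst1 := ds1 (N'N _ N't).
  have dpt := dp c _ _ N't Dz; have dpt1 := dp (c - 1) _ _ N't Dz.
  have dQt1 := dQ1 (N'N _ N't) Dz.
  apply: is_derive_eq.
  by rewrite /spow2 /GRing.scale/=; ring.
have D0 := @is_derive_integral R _ T mu D mD phi iphi spow spow1 x r' m0 d0 b0 b1.
have D1 := @is_derive_integral R _ T mu D mD phi iphi spow1 spow2 x r' m1 d1 b1 b2.
have bx (f : R -> T -> R) : bounded_on ND' (fun p => f p.1 p.2) -> bounded_on D (f x).
  by move=> [C fC]; exists C => z Dz; exact: (fC (x, z)).
split.
- exact: (near_itv r'0).
- exact: D1.
- by apply: integrable_boundedM => //; [exact: m0|exact: bx].
- by apply: integrable_boundedM => //; [exact: m1|exact: bx].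
- by apply: integrable_boundedM => //; [exact: m2|exact: bx].
Qed.

End second_derivative_integral_powR.

(** * Row vectors and coordinates of the hyperbolic space *)

Section compact_bounds.
Context {R : realType} {V : topologicalType}.
Implicit Types (K : set V) (f : V -> R).

Lemma continuous_compact_bounded_on K f : compact K ->
  (forall z, K z -> {for z, continuous f}) -> bounded_on K f.
Proof.
move=> cK cf; have : compact (f @` K).
  apply: continuous_compact => //; apply: continuous_in_subspaceT => z.
  by rewrite inE; exact: cf.
move=> /compact_bounded[M [_ fM]]; exists (M + 1) => z Kz.
by apply: (fM (M + 1)); [rewrite ltrDl|exists z].
Qed.

(** The inverse of [f] is continuous on [K], hence bounded; inverting a positive bound gives [e],
    also for an empty [K]. *)
Lemma continuous_compact_gt0 K f : compact K ->
  (forall z, K z -> {for z, continuous f}) -> (forall z, K z -> 0 < f z) ->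
  exists2 e, 0 < e & forall z, K z -> e <= f z.
Proof.
move=> cK cf f0.
have [|B fB] := @continuous_compact_bounded_on K (fun z => (f z)^-1) cK.
  by move=> z Kz; apply: cvgV; [exact: lt0r_neq0 (f0 _ Kz)|exact: cf].
have B1 : 0 < `|B| + 1 by rewrite ltr_wpDl.
exists (`|B| + 1)^-1; first by rewrite invr_gt0.
move=> z Kz; have fz0 := f0 _ Kz.
rewrite -[leRHS]invrK lef_pV2 ?posrE ?invr_gt0//.
rewrite (le_trans (ler_norm _))// (le_trans (fB _ Kz))//.
by rewrite (le_trans (ler_norm _))// lerDl.
Qed.

End compact_bounds.

(** * Measurability of functions of a row vector *)

Section row_measurability.
Context {R : realType} {m : nat}.
Local Notation V := 'rV[R]_m.+1.
Local Notation T := (m.+1.-tuple (measurableTypeR R)).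
Local Notation row := (@row_of_tuple R m).

Lemma measurable_row_coord (i : 'I_m.+1) : measurable_fun setT (fun t : T => row t 0 i).
Proof.
rewrite (_ : (fun t => _) = (fun t : T => tnth t i)); first exact: measurable_tnth.
by apply/funext => t; rewrite mxE.
Qed.

(** Measurable sets of tuples are generated by the coordinates, open sets of rows by the sup norm.
    The link is that an open set is the union of the countably many rational boxes contained in
    it. *)
Lemma measurable_row_preimage_open (O : set V) : open O -> measurable (row @^-1` O).
Proof.
move=> oO.
pose box (p : 'rV[rat]_m.+1 * rat) : set V :=
  [set z | forall i, `|ratr (p.1 0 i) - z 0 i| < ratr p.2].
pose F p := if `[< box p `<=` O >] then row @^-1` (box p) else set0.
have -> : row @^-1` O = \bigcup_p F p.
  apply/seteqP; split => t /=; last first.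
    by move=> [p _]; rewrite /F; case: ifPn => // /asboolP pO /pO.
  move=> Ot; have /nbhs_ballP[e /= e0 eO] := open_nbhs_nbhs (conj oO Ot).
  (* With r < e/2, a box of radius r that contains [row t] lies in the ball of radius e around
     it. *)
  have [r /andP[r0 re]] : exists r : rat, 0 < (ratr r : R) < e / 2.
    have [|r] := @rat_in_itvoo R 0 (e / 2); first by rewrite divr_gt0.
    by rewrite in_itv/= => rr; exists r.
  have qP i : exists q : rat, `|ratr q - row t 0 i| < ratr r.
    have [|q] := @rat_in_itvoo R (row t 0 i - ratr r) (row t 0 i + ratr r).
      lra.
    by rewrite in_itv/= -ltr_distl => ?; exists q.
  have [q {}qP] := choice qP.
  exists (\row_i q i, r) => //; rewrite /F.
  have -> : `[< box (\row_i q i, r) `<=` O >]; last first.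
    by move=> i /=; rewrite mxE.
  apply/asboolP => z bz; apply: eO; split=> // k i; rewrite ord1 /ball/=.
  have := bz i; rewrite /= mxE; move: (qP i).
  by rewrite !ltr_norml => /andP[? ?] /andP[? ?]; apply/andP; split; lra.
apply: countable_bigcupT_measurable => //= p; rewrite /F; case: ifPn => // _.
rewrite (_ : _ @^-1` _ = \bigcap_(i in [set: 'I_m.+1])
   ((fun t : T => ratr (p.1 0 i) - row t 0 i) @^-1` `]- ratr p.2, ratr p.2[%classic)).
  apply: fin_bigcap_measurable => // i _; rewrite -[X in measurable X]setTI.
  have mi : measurable_fun setT (fun t : T => ratr (p.1 0 i) - row t 0 i).
    by apply: measurable_funB => //; exact: measurable_row_coord.
  by apply: mi.
apply/seteqP; split => t /=.
  by move=> H i _; rewrite /= in_itv/= -ltr_norml; exact: H.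
by move=> H i; have := H i Logic.I; rewrite /= in_itv/= -ltr_norml.
Qed.

Lemma measurable_row_preimage_closed (C : set V) : closed C -> measurable (row @^-1` C).
Proof.
move=> cC; rewrite -[row @^-1` C]setCK preimage_setC; apply: measurableC.
by apply: measurable_row_preimage_open; exact: closed_openC.
Qed.

(** Preimages of open intervals generate, and inside [O], where [f] is continuous, they are open. *)
Lemma measurable_row_continuous (O : set V) (f : V -> R) : open O ->
  (forall z, O z -> {for z, continuous f}) ->
  measurable_fun (row @^-1` O) (f \o row).
Proof.
move=> oO cf.
have mO : measurable (row @^-1` O) by exact: measurable_row_preimage_open.
apply: (measurability _ (RGenOpens.measurableE R)) => //.
move=> _ [_ [a [b ->] <-]]; rewrite -[X in _ `&` X]/(row @^-1` (f @^-1` `]a, b[)).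
rewrite -preimage_setI.
apply: measurable_row_preimage_open; rewrite openE => z [Oz fz].
apply: filterI; first exact: open_nbhs_nbhs.
by apply: cf => //; apply: open_nbhs_nbhs; split=> //; exact: interval_open.
Qed.

End row_measurability.

Section coordinates.
Context {R : realType} {m : nat}.
Implicit Types w z : 'rV[R]_m.+1.

Lemma continuous_xlast : continuous (@xlast R m).
Proof. by move=> z; exact: coord_continuous. Qed.

Lemma open_Hn : open (@Hn R m).
Proof.
rewrite (_ : Hn = xlast @^-1` `]0, +oo[%classic).
  by apply: open_comp => // z _; exact: continuous_xlast.
by apply/seteqP; split => z /=; rewrite in_itv/= andbT.
Qed.

Lemma continuous_sqr_dist w : continuous (sqr_dist w).
Proof.
apply: continuous_big; first exact: add_continuous.
move=> i _ z.
apply: (continuous_comp (f := fun z : 'rV[R]_m.+1 => w 0 i - z 0 i)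
  (g := fun x : R => x ^+ 2)); last exact: exprn_continuous.
exact: (continuousB (@cst_continuous _ _ (w 0 i) z) (@coord_continuous R 1 m.+1 0 i z)).
Qed.

Lemma sqr_dist_ge0 w z : 0 <= sqr_dist w z.
Proof. by apply: sumr_ge0 => i _; exact: sqr_ge0. Qed.

(** On H^n this is [kernel_denominator] without [hdist]: rational in the coordinates, hence
    explicitly differentiable. *)
Definition denom y w z : R :=
  2 - 2 * cos y + sqr_dist w z / (xlast w * xlast z).

(** [hdist_spec] prescribes cosh at half the distance, the kernel uses it at the whole distance. *)
Lemma cosh_double (x : R) : cosh x = 2 * cosh (x / 2) ^+ 2 - 1.
Proof.
rewrite /cosh {1 2}(_ : x = x / 2 + x / 2); last by field.
rewrite opprD !expRD; have : expR (x / 2) * expR (- (x / 2)) = 1.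
  by rewrite -expRD subrr expR0.
set a := expR (x / 2); set b := expR _ => ab.
have -> : 2 * ((a + b) / 2) ^+ 2 - 1 = (a * a + b * b) / 2 + (a * b - 1) by field.
by rewrite ab subrr addr0.
Qed.

Lemma kernel_denominatorE y w z : Hn w -> Hn z ->
  kernel_denominator y w z = denom y w z.
Proof.
move=> w0 z0; have [_ E] := hdistP w0 z0.
rewrite /kernel_denominator cosh_double E /denom.
have ? : xlast w != 0 by rewrite gt_eqF.
have ? : xlast z != 0 by rewrite gt_eqF.
by field; apply/andP; split.
Qed.

Lemma continuous_denom y w z : Hn w -> Hn z -> {for z, continuous (denom y w)}.
Proof.
move=> w0 z0.
have c2 : {for z, continuous (fun z => xlast w * xlast z)}.
  exact: (continuousM (@cst_continuous _ _ (xlast w) z) (@continuous_xlast z)).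
have c3 : {for z, continuous (fun z => (xlast w * xlast z)^-1)}.
  by apply: continuousV c2; rewrite mulf_neq0// gt_eqF.
exact: (continuousD (@cst_continuous _ _ (2 - 2 * cos y) z)
  (continuousM (@continuous_sqr_dist w z) c3)).
Qed.

Lemma denom_ge y w z : Hn w -> Hn z -> 2 - 2 * cos y <= denom y w z.
Proof.
move=> w0 z0; rewrite lerDl divr_ge0 ?sqr_dist_ge0// mulr_ge0// ltW//.
Qed.

Lemma denom_ge0 y w z : Hn w -> Hn z -> 0 <= denom y w z.
Proof.
move=> w0 z0; apply: le_trans (denom_ge _ w0 z0).
by have := cos_le1 y; lra.
Qed.

End coordinates.

(** * Integrals over the support of the datum *)

Section compactly_supported.
Context {R : realType} {m : nat}.
Local Notation V := 'rV[R]_m.+1.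
Local Notation T := (m.+1.-tuple (measurableTypeR R)).
Local Notation row := (@row_of_tuple R m).
Local Notation leb := (@lebesgue_Rn R m.+1).
Variable u : V -> R.
Hypothesis su : smooth_compact u.

Definition supp : set T := row @^-1` hsupport u.

(** The part of the integrand that depends neither on y nor on w: the datum times the density of the
    hyperbolic volume. *)
Definition weight (t : T) : R := u (row t) * xlast (row t) ^- m.+1.

Lemma compact_hsupport : compact (hsupport u).
Proof. by have [_ +] := su. Qed.

Lemma hsupport_Hn : hsupport u `<=` Hn.
Proof. by have [_ _ +] := su. Qed.

Lemma supp_Hn t : supp t -> Hn (row t).
Proof. exact: hsupport_Hn. Qed.

Lemma hsupport_neq0 z : Hn z -> u z != 0 -> hsupport u z.
Proof. by move=> z0 uz; exact: subset_closure. Qed.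

Lemma measurable_supp : measurable supp.
Proof. by apply: measurable_row_preimage_closed; exact: closed_closure. Qed.

Lemma continuous_u z : Hn z -> {for z, continuous u}.
Proof. by have [su0 _ _] := su; move=> /(su0 [::])[]. Qed.

Lemma measurable_supp_continuous (f : V -> R) :
  (forall z, Hn z -> {for z, continuous f}) -> measurable_fun supp (f \o row).
Proof.
move=> cf; apply: (@measurable_funS _ _ _ _ (row @^-1` Hn)).
- by apply: measurable_row_preimage_open; exact: open_Hn.
- exact: supp_Hn.
- by apply: measurable_row_continuous => //; exact: open_Hn.
Qed.

Lemma bounded_supp_continuous (f : V -> R) :
  (forall z, Hn z -> {for z, continuous f}) -> bounded_on supp (f \o row).
Proof.
move=> cf; apply: (@bounded_on_comp _ _ _ _ (hsupport u)) => //.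
apply: continuous_compact_bounded_on; first exact: compact_hsupport.
by move=> z /hsupport_Hn; exact: cf.
Qed.

Lemma gt0_supp_continuous (f : V -> R) :
  (forall z, Hn z -> {for z, continuous f}) ->
  (forall z, hsupport u z -> 0 < f z) ->
  exists2 e, 0 < e & forall t, supp t -> e <= f (row t).
Proof.
move=> cf f0; have [|e e0 ef] := continuous_compact_gt0 compact_hsupport _ f0.
  by move=> z /hsupport_Hn; exact: cf.
by exists e => // t; exact: ef.
Qed.

(** Each coordinate is bounded on the compact support, which therefore lies in a product of bounded
    intervals. *)
Lemma supp_finite : (leb supp < +oo)%E.
Proof.
have /choice[B coordB] (i : 'I_m.+1) :
    exists B, forall t, supp t -> `|tnth t i| <= B.
  have [|B cB] := @bounded_supp_continuous (fun z => z 0 i).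
    by move=> z _; exact: coord_continuous.
  by exists B => t /cB /=; rewrite mxE.
pose box (i : 'I_m.+1) : set (measurableTypeR R) := `[- B i, B i]%classic.
have mbox i : measurable (box i) by exact: measurable_itv.
have sub : supp `<=` [set t | forall i, box i (tnth t i)].
  by move=> t tS i; rewrite /box /= in_itv/= -ler_norml; exact: coordB.
have mBox : measurable [set t : T | forall i, box i (tnth t i)].
  rewrite (_ : mkset _ = \bigcap_(i in [set: 'I_m.+1])
      ((fun t : T => tnth t i) @^-1` box i)).
    apply: fin_bigcap_measurable => // i _.
    by rewrite -[X in measurable X]setTI; exact: measurable_tnth.
  by apply/seteqP; split => t /= Bt => [i _|i]; [exact: Bt|exact: (Bt i Logic.I)].
apply: (le_lt_trans (le_measure _ _ _ sub)); rewrite ?inE//.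
  exact: measurable_supp.
rewrite [ltLHS](_ : _ = (\prod_(i < m.+1) lebesgue_measure (box i))%E); last first.
  exact: lebesgue_Rn_box.
rewrite ltey_eq; apply/orP; left; apply: (big_ind (fun x => x \is a fin_num)) => //.
  by move=> x y x0 y0; rewrite fin_numM.
by move=> i _; rewrite /box lebesgue_measure_itv/=; case: ifPn.
Qed.

Lemma integrable_supp_continuous (f : V -> R) :
  (forall z, Hn z -> {for z, continuous f}) ->
  leb.-integrable supp (EFin \o (f \o row)).
Proof.
move=> cf; apply: measurable_bounded_integrable.
- exact: measurable_supp.
- exact: supp_finite.
- exact: measurable_supp_continuous.
- have [B fB] := bounded_supp_continuous cf.
  exists B; split; first exact: num_real.
  by move=> M BM t /fB tB; exact: le_trans tB (ltW BM).
Qed.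

Lemma continuous_weight z : Hn z ->
  {for z, continuous (fun z => u z * xlast z ^- m.+1)}.
Proof.
move=> z0; apply: continuousM; first exact: continuous_u.
apply: continuousV; first by rewrite expf_neq0// gt_eqF.
apply: (continuous_comp (g := fun x : R => x ^+ m.+1)); first exact: continuous_xlast.
exact: exprn_continuous.
Qed.

Lemma integrable_weight : leb.-integrable supp (EFin \o weight).
Proof. exact: (integrable_supp_continuous continuous_weight). Qed.

(** At points of H^n outside the support the datum is 0, so both extensions by zero agree
    everywhere, whatever [k] is. *)
Lemma hintegrand_patch (k : V -> R) :
  hintegrand (fun z => k z * u z) \_ (row @^-1` Hn) =
  (fun t => k (row t) * weight t) \_ supp.
Proof.
apply/funext => t; rewrite !patchE /hintegrand /weight.
case: (boolP (t \in supp)) => [/set_mem tS|tS].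
  by rewrite mem_set/= ?mulrA//; exact: supp_Hn.
case: ifPn => // /set_mem /= tH; apply/eqP; rewrite mulf_eq0 mulf_eq0.
have -> : u (row t) = 0; last by rewrite eqxx orbT.
apply/eqP/negPn/negP => ut; move/negP : tS; apply.
by apply/mem_set; exact: hsupport_neq0.
Qed.

Lemma hintegralE (k : V -> R) :
  hintegral (fun z => k z * u z) =
  \int[leb]_(t in supp) (k (row t) * weight t).
Proof. by rewrite /hintegral Rintegral_mkcond hintegrand_patch -Rintegral_mkcond. Qed.

Lemma hintegrableP (k : V -> R) :
  leb.-integrable supp (fun t => (k (row t) * weight t)%:E) ->
  hintegrable (fun z => k z * u z).
Proof.
have E (f : T -> R) D : EFin \o (f \_ D) = (EFin \o f) \_ D.
  by apply/funext => t /=; rewrite !patchE; case: ifPn.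
have mH : measurable (row @^-1` (@Hn R m)).
  by apply: measurable_row_preimage_open; exact: open_Hn.
move=> /(integrable_mkcond _ measurable_supp) ik.
by apply/(integrable_mkcond _ mH); rewrite -E hintegrand_patch E.
Qed.

End compactly_supported.

(** * The Poisson equation *)

Section linear_combination_of_integrals.
Context {R : realType} d {T : measurableType d} (mu : {measure set T -> \bar R}).
Variables (D : set T) (mD : measurable D).
Implicit Types (f g : T -> R) (v : R).

(** The real integral is a total operator and is linear only on integrable functions; carrying
    integrability along with the value lets sums be formed term by term. *)
Definition has_Rintegral f v :=
  mu.-integrable D (EFin \o f) /\ \int[mu]_(x in D) f x = v.

Lemma has_RintegralD f g v v' : has_Rintegral f v -> has_Rintegral g v' ->
  has_Rintegral (fun x => f x + g x) (v + v').
Proof.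
move=> [fi <-] [gi <-]; split; last by rewrite -RintegralD.
rewrite (_ : _ \o _ = (EFin \o f) \+ (EFin \o g))%E//.
exact: integrableD.
Qed.

Lemma has_RintegralZ k f v : has_Rintegral f v ->
  has_Rintegral (fun x => k * f x) (k * v).
Proof.
move=> [fi <-]; split; last by rewrite -RintegralZl.
rewrite /comp; under eq_fun do rewrite EFinM.
exact: integrableZl.
Qed.

Lemma has_Rintegral_sum (I : Type) (r : seq I) (P : pred I) (F : I -> T -> R)
    (V : I -> R) : (forall i, has_Rintegral (F i) (V i)) ->
  has_Rintegral (fun x => \sum_(i <- r | P i) F i x) (\sum_(i <- r | P i) V i).
Proof.
move=> FV; elim: r => [|i r IH].
  under eq_fun do rewrite big_nil.
  rewrite big_nil; split; last by rewrite Rintegral_cst// mul0r.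
  exact: integrable0.
under eq_fun do rewrite big_cons.
by rewrite big_cons; case: (P i) => //; exact: has_RintegralD.
Qed.

End linear_combination_of_integrals.

(** * Derivatives of the Poisson integral and the pointwise identity *)

Section poisson_derivatives.
Context {R : realType} {m : nat}.
Local Notation V := 'rV[R]_m.+1.
Local Notation T := (m.+1.-tuple (measurableTypeR R)).
Local Notation row := (@row_of_tuple R m).
Local Notation leb := (@lebesgue_Rn R m.+1).
Local Notation a := ((m.+1%:R + 1) / 2 : R).
Variable u : V -> R.
Hypothesis su : smooth_compact u.

Definition poisson_cst : R := Gamma a / (pi `^ a).

Lemma poisson_integralE y (w : V) : Hn w ->
  poisson_integral u y w =
  \int[leb]_(t in supp u) (poisson_cst * sin y * denom y w (row t) `^ (- a) * weight u t).
Proof.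
move=> w0; rewrite /poisson_integral hintegralE//.
apply: eq_Rintegral => t /set_mem /(supp_Hn su) t0; congr (_ * _).
by rewrite /poisson_kernel kernel_denominatorE// powRN mulrA.
Qed.

Lemma denom_gt0 y (w z : V) : nonsingular u y w -> Hn w -> hsupport u z ->
  0 < denom y w z.
Proof.
move=> ns w0 zS; have z0 := hsupport_Hn su zS.
by rewrite lt_def denom_ge0// andbT -kernel_denominatorE// ns.
Qed.

Lemma cos_lt1_nonsingular y (w : V) : Hn w -> cos y < 1 -> nonsingular u y w.
Proof.
move=> w0 cosy1 z /(hsupport_Hn su) z0; rewrite kernel_denominatorE// gt_eqF//.
by apply: lt_le_trans (denom_ge y w0 z0); lra.
Qed.

Variables (y : R) (w : V).
Hypotheses (w0 : Hn w) (ns : nonsingular u y w).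

(** Nonsingularity gives positivity at each point of the support; compactness makes it uniform. *)
Let denom_lb : exists2 e, 0 < e & forall t, supp u t -> e <= denom y w (row t).
Proof.
apply: gt0_supp_continuous => // [z z0|z zS]; first exact: continuous_denom.
exact: denom_gt0.
Qed.

(** Data of [spow] for the variable y. It enters [denom] through cos y alone, so [Qy1] and [Qy2] are
    constant in the point of integration. *)
Let s (t : R) : R := poisson_cst * sin t.
Let s1 (t : R) : R := poisson_cst * cos t.
Let s2 (t : R) : R := poisson_cst * - sin t.
Let Qy t (z : T) : R := denom t w (row z).
Let Qy1 t (_ : T) : R := 2 * sin t.
Let Qy2 t (_ : T) : R := 2 * cos t.

Let aN_le0 : - a <= 0.
Proof. by rewrite oppr_le0 divr_ge0// addr_ge0. Qed.

Lemma poisson_derive_y :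
  [/\ derivable ((poisson_integral u)^~ w) y 1,
      derivable (derive1 ((poisson_integral u)^~ w)) y 1,
      derive1n 2 ((poisson_integral u)^~ w) y =
        \int[leb]_(z in supp u) (spow2 (- a) s s1 s2 Qy Qy1 Qy2 y z * weight u z)
    & leb.-integrable (supp u)
       (fun z => (spow2 (- a) s s1 s2 Qy Qy1 Qy2 y z * weight u z)%:E)].
Proof.
have [e e0 Qe] := denom_lb.
have bsin N : bounded_on N (@sin R).
  by exists 1 => x _; rewrite ler_norml sin_geN1 sin_le1.
have bcos N : bounded_on N (@cos R).
  by exists 1 => x _; rewrite ler_norml cos_geN1 cos_le1.
have [] := @integral_spow_second_derive R _ T leb (supp u) (measurable_supp u)
  (weight u) (integrable_weight su) (- a) y 1 e s s1 s2 Qy Qy1 Qy2 ltr01 e0 aN_le0.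
- by apply: bounded_onM; [exact: bounded_on_cst|exact: bsin].
- by apply: bounded_onM; [exact: bounded_on_cst|exact: bcos].
- by apply: bounded_onM; [exact: bounded_on_cst|apply: bounded_onN; exact: bsin].
- move=> t _; apply: (measurable_supp_continuous su) => z z0.
  exact: continuous_denom.
- by move=> t _; exact: measurable_cst.
- by move=> t _; exact: measurable_cst.
- move=> t z _ _; rewrite /Qy /Qy1 /denom.
  by apply: is_derive_eq; rewrite /GRing.scale/=; ring.
- apply: bounded_onM; first exact: bounded_on_cst.
  by apply: (bounded_on_comp (h := fst) (B := setT)) => //; exact: bsin.
- apply: bounded_onM; first exact: bounded_on_cst.
  by apply: (bounded_on_comp (h := fst) (B := setT)) => //; exact: bcos.
- exact: Qe.
move=> d0 d1 _ _ i2.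
have E : (poisson_integral u)^~ w = fun t =>
    \int[leb]_(z in supp u) (spow (- a) s Qy t z * weight u z).
  by apply/funext => t; rewrite poisson_integralE.
have [? ? ? ?] := second_derive d0 d1.
by rewrite !E; split.
Qed.

(* Moving along coordinate i changes w_n at the rate d i, which is 0 or 1; this
   treats the last coordinate together with the others. *)
Let d i : R := (i == @ord_max m)%:R.
Let cs (_ : R) : R := poisson_cst * sin y.
Let N i (h : R) z : R := sqr_dist w z + 2 * h * (w 0 i - z 0 i) + h ^+ 2.
Let N1 i (h : R) (z : V) : R := 2 * (w 0 i - z 0 i) + 2 * h.
Let X i (h : R) : R := xlast w + h * d i.
Let Q i (h : R) (z : T) : R := denom y (h *: basis_vec i + w) (row z).
Let Q1 i (h : R) (t : T) : R := let z := row t in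
  (N1 i h z / X i h - d i * N i h z / X i h ^+ 2) / xlast z.
Let Q2 i (h : R) (t : T) : R := let z := row t in
  (2 / X i h - 2 * d i * N1 i h z / X i h ^+ 2 +
   2 * d i ^+ 2 * N i h z / X i h ^+ 3) / xlast z.

Let translE i h j : (h *: basis_vec i + w) 0 j = w 0 j + h * (j == i)%:R.
Proof. by rewrite !mxE eqxx/= addrC. Qed.

Let xlastE i h : xlast (h *: basis_vec i + w) = X i h.
Proof. by rewrite /xlast translE /X /d eq_sym. Qed.

Let NE i h z : sqr_dist (h *: basis_vec i + w) z = N i h z.
Proof.
rewrite /N /sqr_dist (bigD1 i)//= [in RHS](bigD1 i)//= translE eqxx mulr1.
rewrite [in LHS](eq_bigr (fun j => (w 0 j - z 0 j) ^+ 2)); first by ring.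
by move=> j ji; rewrite translE (negbTE ji) mulr0 addr0.
Qed.

Let QE i h t : Q i h t = 2 - 2 * cos y + N i h (row t) / (X i h * xlast (row t)).
Proof. by rewrite /Q /denom NE xlastE. Qed.

Let d01 i : 0 <= d i <= 1.
Proof. by rewrite /d; case: eqP; rewrite ?lexx ?ler01. Qed.

(** Moves shorter than w_n/2 keep the point in H^n and the inverse of [X] bounded; this is the
    radius used for the derivatives in w. *)
Let X_ge i h : `|h - 0| < xlast w / 2 -> xlast w / 2 <= X i h.
Proof.
rewrite subr0 ltr_norml /X => /andP[h1 h2]; have /andP[? ?] := d01 i.
have := w0; rewrite /Hn/= => ?; nra.
Qed.

(** [integral_spow_second_derive] along the line through w in direction i, at h = 0; sin y is now a
    constant factor, whence the zero derivatives of [cs]. *)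
Lemma poisson_derive_w (i : 'I_m.+1) :
  [/\ derivable (poisson_integral u y) w (basis_vec i) /\
      derivable (partial i (poisson_integral u y)) w (basis_vec i),
      partial i (poisson_integral u y) w =
        \int[leb]_(z in supp u)
          (spow1 (- a) cs (fun=> 0) (Q i) (Q1 i) 0 z * weight u z),
      partial i (partial i (poisson_integral u y)) w =
        \int[leb]_(z in supp u)
          (spow2 (- a) cs (fun=> 0) (fun=> 0) (Q i) (Q1 i) (Q2 i) 0 z * weight u z),
      leb.-integrable (supp u) (fun z =>
        (spow1 (- a) cs (fun=> 0) (Q i) (Q1 i) 0 z * weight u z)%:E)
    & leb.-integrable (supp u) (fun z =>
        (spow2 (- a) cs (fun=> 0) (fun=> 0) (Q i) (Q1 i) (Q2 i) 0 z * weight u z)%:E)].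
Proof.
have [e e0 Qe] := denom_lb.
have xw : 0 < xlast w by [].
have r0 : 0 < xlast w / 2 by rewrite divr_gt0.
have X0 h : `|h - 0| < xlast w / 2 -> 0 < X i h.
  by move=> /(X_ge i); exact: lt_le_trans.
have czi (z : V) : {for z, continuous (fun z : V => w 0 i - z 0 i)}.
  exact: (continuousB (@cst_continuous _ _ (w 0 i) z)
    (@coord_continuous R 1 m.+1 0 i z)).
have cN h (z : V) : {for z, continuous (N i h)}.
  apply: continuousD; last exact: cst_continuous.
  apply: continuousD; first exact: continuous_sqr_dist.
  by apply: continuousM; [exact: cst_continuous|exact: czi].
have cN1 h (z : V) : {for z, continuous (N1 i h)}.
  apply: continuousD; last exact: cst_continuous.
  by apply: continuousM; [exact: cst_continuous|exact: czi].
have cxV (z : V) : Hn z -> {for z, continuous (fun z : V => (xlast z)^-1)}.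
  move=> z0; apply: continuousV; first by rewrite gt_eqF.
  exact: continuous_xlast.
have mN h : measurable_fun (supp u) (N i h \o row).
  by apply: (measurable_supp_continuous su) => z _; exact: cN.
have mN1 h : measurable_fun (supp u) (N1 i h \o row).
  by apply: (measurable_supp_continuous su) => z _; exact: cN1.
have mxV : measurable_fun (supp u) (fun t => (xlast (row t))^-1).
  by apply: (measurable_supp_continuous (f := fun z => (xlast z)^-1) su) => z; exact: cxV.
pose ND : set (R * T) := [set p | `|p.1 - 0| < xlast w / 2 /\ supp u p.2].
have bfst : bounded_on ND fst.
  by exists (xlast w / 2) => -[h t] [/= + _]; rewrite subr0 => /ltW.
have bsnd (f : V -> R) : (forall z, Hn z -> {for z, continuous f}) ->
    bounded_on ND (fun p => f (row p.2)).
  move=> cf; apply: (@bounded_on_comp R _ _ _ (supp u) snd (f \o row)).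
    by move=> [h t] [].
  exact: (bounded_supp_continuous su cf).
have bN : bounded_on ND (fun p => N i p.1 (row p.2)).
  apply: bounded_onD; last exact: bounded_onX.
  apply: bounded_onD; first by apply: bsnd => z _; exact: continuous_sqr_dist.
  apply: bounded_onM; first by apply: bounded_onM => //; exact: bounded_on_cst.
  by apply: (bsnd (fun z => w 0 i - z 0 i)) => z _; exact: czi.
have bN1 : bounded_on ND (fun p => N1 i p.1 (row p.2)).
  apply: bounded_onD; last by apply: bounded_onM => //; exact: bounded_on_cst.
  apply: bounded_onM; first exact: bounded_on_cst.
  by apply: (bsnd (fun z => w 0 i - z 0 i)) => z _; exact: czi.
have bXV n : bounded_on ND (fun p => (X i p.1 ^+ n)^-1).
  have bX : bounded_on ND (fun p => (X i p.1)^-1).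
    by apply: (bounded_onV r0) => -[h t] [/= hr _]; exact: X_ge.
  by have := bounded_onX n bX; under eq_fun do rewrite exprVn.
have bxV : bounded_on ND (fun p => (xlast (row p.2))^-1).
  exact: (bsnd (fun z => (xlast z)^-1)).
have dX (h : R) : is_derive h 1 (X i) (d i).
  by apply: is_derive_eq; rewrite /GRing.scale/=; ring.
have dXV (h : R) : `|h - 0| < xlast w / 2 ->
    is_derive h 1 (fun h => (X i h)^-1) (- d i / X i h ^+ 2).
  move=> /X0 Xh; have Xn0 : X i h != 0 by rewrite gt_eqF.
  have dXh := dX h.
  apply: is_derive_eq.
  by rewrite /GRing.scale/=; field.
have dN (h : R) z : is_derive h 1 (fun h => N i h z) (N1 i h z).
  by apply: is_derive_eq; rewrite /N1 /GRing.scale/=; ring.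
have dN1 (h : R) z : is_derive h 1 (fun h => N1 i h z) 2.
  by apply: is_derive_eq; rewrite /GRing.scale/=; ring.
(* The inverse of [X] is isolated as a factor, to be differentiated by [dXV]. *)
have Qfun : Q i = fun h t => 2 - 2 * cos y + N i h (row t) * (X i h)^-1 * (xlast (row t))^-1.
  by apply/funext => h; apply/funext => t; rewrite QE invfM mulrA.
have [] := @integral_spow_second_derive R _ T leb (supp u) (measurable_supp u)
  (weight u) (integrable_weight su) (- a) 0 (xlast w / 2) e cs (fun=> 0) (fun=> 0)
  (Q i) (Q1 i) (Q2 i) r0 e0 aN_le0.
- exact: bounded_on_cst.
- exact: bounded_on_cst.
- exact: bounded_on_cst.
- move=> h _; rewrite Qfun; apply: measurable_funD => //.
  by apply: measurable_funM => //; apply: measurable_funM => //; exact: mN.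
- move=> h _; apply: measurable_funM => //; apply: measurable_funB.
    by apply: measurable_funM => //; exact: mN1.
  apply: measurable_funM => //; apply: measurable_funM => //; exact: mN.
- move=> h _; apply: measurable_funM => //; apply: measurable_funD.
    apply: measurable_funB => //.
    by apply: measurable_funM => //; apply: measurable_funM => //; exact: mN1.
  by apply: measurable_funM => //; apply: measurable_funM => //; exact: mN.
- move=> h t hr tS; rewrite Qfun /Q1.
  have Xh := X0 _ hr; have dXVh := dXV _ hr; have dNh := dN h (row t).
  have Xn0 : X i h != 0 by rewrite gt_eqF.
  have xn0 : xlast (row t) != 0 by rewrite gt_eqF//; exact: (supp_Hn su).
  apply: is_derive_eq; rewrite /GRing.scale/=; field.
  by rewrite Xn0 xn0.
- move=> h t hr tS; rewrite /Q1 /Q2.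
  have Xh := X0 _ hr; have dXVh := dXV _ hr; have dNh := dN h (row t).
  have dN1h := dN1 h (row t).
  have Xn0 : X i h != 0 by rewrite gt_eqF.
  have xn0 : xlast (row t) != 0 by rewrite gt_eqF//; exact: (supp_Hn su).
  under eq_fun do rewrite -exprVn.
  apply: is_derive_eq; rewrite /GRing.scale/=; field.
  by rewrite Xn0 xn0.
- apply: bounded_onM; last exact: bxV.
  apply: bounded_onB; first by apply: bounded_onM => //; exact: (bXV 1%N).
  apply: bounded_onM; last exact: bXV.
  by apply: bounded_onM => //; exact: bounded_on_cst.
- apply: bounded_onM; last exact: bxV.
  apply: bounded_onD; first apply: bounded_onB.
  + by apply: bounded_onM; [exact: bounded_on_cst|exact: (bXV 1%N)].
  + apply: bounded_onM; last exact: bXV.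
    by apply: bounded_onM => //; exact: bounded_on_cst.
  + apply: bounded_onM; last exact: bXV.
    by apply: bounded_onM => //; exact: bounded_on_cst.
- by move=> t tS; rewrite /Q scale0r add0r; exact: Qe.
move=> d0 d1 _ i1 i2.
have nE : \forall h \near (0 : R), poisson_integral u y (h *: basis_vec i + w) =
    \int[leb]_(z in supp u) (spow (- a) cs (Q i) h z * weight u z).
  apply: (near_itv r0) => h hr.
  by rewrite poisson_integralE//= /Hn/= xlastE X0.
have nd : \forall h \near (0 : R), is_derive (h : R) (1 : R)
    (fun h : R => poisson_integral u y (h *: basis_vec i + w))
    (\int[leb]_(z in supp u) (spow1 (- a) cs (fun=> 0) (Q i) (Q1 i) h z * weight u z)).
  (* A derivative at h involves the values around h, so the integral formula is needed on a
     neighbourhood of each h close to 0. *)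
  have nnE := near_join nE.
  near=> h; apply: (near_eq_is_derive (f := fun h : R =>
     \int[leb]_(z in supp u) (spow (- a) cs (Q i) h z * weight u z))); last by near: h.
  have : \forall h' \near h, poisson_integral u y (h' *: basis_vec i + w) =
    \int[leb]_(z in supp u) (spow (- a) cs (Q i) h' z * weight u z) by near: h.
  by apply: filterS => h' ->.
have [? ? ? ?] := second_derive_dir nd d1.
by split.
Unshelve. all: by end_near. Qed.

Lemma poisson_integrable :
  leb.-integrable (supp u) (fun t =>
    (poisson_cst * sin y * denom y w (row t) `^ (- a) * weight u t)%:E).
Proof.
have [e e0 Qe] := denom_lb.
apply: (integrable_boundedM (measurable_supp u) (integrable_weight su)
  (g := fun t => poisson_cst * sin y * denom y w (row t) `^ (- a))).
  apply: measurable_funM => //; apply: (measurableT_comp (f := fun x : R => x `^ (- a))).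
    exact: measurable_powR.
  by apply: (measurable_supp_continuous su) => z; exact: continuous_denom.
apply: bounded_onM; first exact: bounded_on_cst.
exact: (bounded_on_powR e0 aN_le0).
Qed.

(** All powers of q = [denom] are multiples of [E2], the power of exponent c - 2. Eliminating the
    tangential part of the distance through the definition of q, and sin^2 y through cos^2 y, leaves
    a rational identity which holds for c = -(n+1)/2. *)
Lemma poisson_pde_pointwise t : supp u t ->
  xlast w ^+ 2 * (\sum_(j < m.+1 | j != ord_max)
     spow2 (- a) cs (fun=> 0) (fun=> 0) (Q j) (Q1 j) (Q2 j) 0 t * weight u t)
  + xlast w ^+ 2 * (spow2 (- a) cs (fun=> 0) (fun=> 0)
      (Q ord_max) (Q1 ord_max) (Q2 ord_max) 0 t * weight u t)
  + (2 - m.+1%:R) * xlast w * (spow1 (- a) cs (fun=> 0)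
      (Q ord_max) (Q1 ord_max) 0 t * weight u t)
  + (m.+1%:R - 1) ^+ 2 / 4 *
      (poisson_cst * sin y * denom y w (row t) `^ (- a) * weight u t)
  + spow2 (- a) s s1 s2 Qy Qy1 Qy2 y t * weight u t = 0.
Proof.
move=> tS; have z0 : 0 < xlast (row t) by exact: (supp_Hn su).
have x0 : 0 < xlast w by [].
have q0 : 0 < denom y w (row t) by exact: denom_gt0.
have Q0 j : Q j 0 t = denom y w (row t) by rewrite /Q scale0r add0r.
have X0 j : X j 0 = xlast w by rewrite /X mul0r addr0.
have N0 j : N j 0 (row t) = sqr_dist w (row t).
  by rewrite /N mulr0 mul0r expr0n !addr0.
have N10 j : N1 j 0 (row t) = 2 * (w 0 j - row t 0 j).
  by rewrite /N1 mulr0 addr0.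
pose c : R := - a.
pose A := \sum_(j < m.+1 | j != ord_max) (w 0 j - row t 0 j) ^+ 2.
have SE : sqr_dist w (row t) = (xlast w - xlast (row t)) ^+ 2 + A.
  by rewrite /sqr_dist (bigD1 ord_max).
pose q := denom y w (row t).
have qE : q * (xlast w * xlast (row t)) = (2 - 2 * cos y) * (xlast w * xlast (row t))
    + sqr_dist w (row t).
  by rewrite /q /denom mulrDl divfK// mulf_neq0// gt_eqF.
(* The definition of q solved for the tangential part [A] of the squared distance. *)
have AE : A = (q - 2 + 2 * cos y) * (xlast w * xlast (row t))
    - (xlast w - xlast (row t)) ^+ 2.
  have {1}-> : A = (2 - 2 * cos y) * (xlast w * xlast (row t)) + sqr_dist w (row t)
      - (2 - 2 * cos y) * (xlast w * xlast (row t)) - (xlast w - xlast (row t)) ^+ 2.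
    by rewrite SE; ring.
  by rewrite -qE; ring.
pose E2 := q `^ (c - 1 - 1).
have E1E : q `^ (c - 1) = q * E2.
  rewrite -{2}[q](@powRr1 R) ?(ltW q0)// -powRD; last by rewrite (gt_eqF q0) implybT.
  by congr powR; ring.
have EE : q `^ c = q ^+ 2 * E2.
  rewrite expr2 -mulrA -E1E -{2}[q](@powRr1 R) ?(ltW q0)// -powRD.
    by congr powR; ring.
  by rewrite (gt_eqF q0) implybT.
(* There are m = n - 1 tangential coordinates, which gives the coefficient [m] of the term common to
   all of them. *)
have sumE : \sum_(j < m.+1 | j != ord_max)
     spow2 (- a) cs (fun=> 0) (fun=> 0) (Q j) (Q1 j) (Q2 j) 0 t * weight u t =
   poisson_cst * sin y * c * (4 * (c - 1) * E2 * A / (xlast w * xlast (row t)) ^+ 2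
     + m%:R * (2 * (q * E2) / (xlast w * xlast (row t)))) * weight u t.
  rewrite -mulr_suml; congr (_ * _).
  rewrite (eq_bigr (fun j => poisson_cst * sin y * c *
      (4 * (c - 1) * E2 / (xlast w * xlast (row t)) ^+ 2 * (w 0 j - row t 0 j) ^+ 2 +
       2 * (q * E2) / (xlast w * xlast (row t))))); last first.
    move=> j jm; rewrite /spow2 /Q1 /Q2 Q0 X0 N0 N10.
    rewrite (_ : d j = 0) ?/d ?(negbTE jm)// -/c -/q E1E -/E2 /cs.
    by field; rewrite !gt_eqF.
  rewrite -mulr_sumr big_split/= -mulr_sumr -/A sumr_const cardC1 card_ord.
  by rewrite -[in LHS]mulr_natl; congr (_ * (_ + _)); ring.
rewrite sumE /spow2 /spow1 /Q1 /Q2 Q0 X0 N0 N10.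
rewrite (_ : d ord_max = 1) ?/d ?eqxx// -/c /Qy -/q E1E EE -/E2 /cs.
rewrite SE AE /s /s1 /s2 /Qy1 /Qy2 -[w 0 ord_max]/(xlast w).
rewrite -[row t 0 ord_max]/(xlast (row t)).
have s2c2 : sin y ^+ 2 = 1 - cos y ^+ 2 by rewrite -(cos2Dsin2 y); ring.
(* One factor sin y stays in front, to match the terms from the derivatives in w; only the remaining
   square is converted to cos y. *)
have -> : poisson_cst * - sin y * (q ^+ 2 * E2) +
   2 * (poisson_cst * cos y) * (c * (q * E2) * (2 * sin y)) +
   poisson_cst * sin y * (c * ((c - 1) * E2 * (2 * sin y) ^+ 2 +
     q * E2 * (2 * cos y))) =
   poisson_cst * sin y * E2 * (- q ^+ 2 + 4 * c * q * cos y +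
     c * (4 * (c - 1) * (1 - cos y ^+ 2) + 2 * q * cos y)).
  by rewrite -s2c2; ring.
rewrite /c -natr1; field.
by rewrite !gt_eqF.
Qed.

(** Every term of the equation is an integral over the support; by linearity the difference of the
    two sides is the integral of the pointwise identity, that is 0. *)
Lemma poisson_pde : poisson_equation_at (poisson_integral u) y w.
Proof.
have [dy dy1 eqy iy] := poisson_derive_y.
have dw := poisson_derive_w.
split => [j||]; [by have [] := dw j|by []|].
rewrite /laplace_beltrami; apply/eqP; rewrite -subr_eq0 opprK eqy; apply/eqP.
pose F2 j t := spow2 (- a) cs (fun=> 0) (fun=> 0) (Q j) (Q1 j) (Q2 j) 0 t * weight u t.
have H2 j : has_Rintegral leb (supp u) (F2 j) (partial j (partial j (poisson_integral u y)) w).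
  by have [_ _ -> _ i2] := dw j; split.
pose F1 t := spow1 (- a) cs (fun=> 0) (Q ord_max) (Q1 ord_max) 0 t * weight u t.
have H1 : has_Rintegral leb (supp u) F1 (partial ord_max (poisson_integral u y) w).
  by have [_ -> _ i1 _] := dw ord_max; split.
have H0 : has_Rintegral leb (supp u) (fun t =>
    poisson_cst * sin y * denom y w (row t) `^ (- a) * weight u t)
    (poisson_integral u y w).
  by rewrite poisson_integralE//; split=> //; exact: poisson_integrable.
have Hy := conj iy (erefl _) : has_Rintegral leb (supp u)
  (fun z => spow2 (- a) s s1 s2 Qy Qy1 Qy2 y z * weight u z) _.
have mS := measurable_supp u.
have [_ <-] := has_RintegralD mS (has_RintegralD mS (has_RintegralD mS (has_RintegralD mS
  (has_RintegralZ mS (xlast w ^+ 2)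
    (has_Rintegral_sum mS (index_enum _) (fun j => j != ord_max) H2))
  (has_RintegralZ mS (xlast w ^+ 2) (H2 ord_max)))
  (has_RintegralZ mS ((2 - m.+1%:R) * xlast w) H1))
  (has_RintegralZ mS ((m.+1%:R - 1) ^+ 2 / 4) H0)) Hy.
rewrite (@eq_Rintegral _ _ _ leb (supp u) (fun=> 0)); last first.
  by move=> t /set_mem tS; exact: poisson_pde_pointwise.
by rewrite Rintegral_cst// mul0r.
Qed.

End poisson_derivatives.

(** * The initial value *)

Lemma continuous_powR_gt0 (R : realType) (c x : R) : 0 < x ->
  {for x, continuous (fun x : R => x `^ c)}.
Proof.
move=> x0; apply: differentiable_continuous; apply/derivable1_diffP.
by have H := is_derive1_powR c x0; exact: ex_derive.
Qed.

(** The nonnegative case applied to positive and negative parts. Integrability makes their integrals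
    finite, hence also the substituted ones since s^n > 0, and the real values can be subtracted. *)
Lemma Rintegral_affine (R : realType) n (w : 'I_n -> R) s
    (g : n.-tuple (measurableTypeR R) -> R) : 0 < s ->
  (lebesgue_Rn n).-integrable setT (EFin \o g) ->
  \int[lebesgue_Rn n]_t g t = s ^+ n * \int[lebesgue_Rn n]_t g (affine_tuple w s t).
Proof.
move=> s0 ig; have sn0 : 0 < s ^+ n by rewrite exprn_gt0.
have mg := measurable_int _ ig.
pose h t := (g (affine_tuple w s t))%:E.
have Ep : (\int[lebesgue_Rn n]_t (EFin \o g)^\+ t =
    (s ^+ n)%:E * \int[lebesgue_Rn n]_t h^\+ t)%E.
  rewrite (@ge0_integral_Rn_affine R n w s)//; last exact: measurable_funepos.
  by rewrite !unlock.
have En : (\int[lebesgue_Rn n]_t (EFin \o g)^\- t =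
    (s ^+ n)%:E * \int[lebesgue_Rn n]_t h^\- t)%E.
  rewrite (@ge0_integral_Rn_affine R n w s)//; last exact: measurable_funeneg.
  by rewrite !unlock.
have := integrable_pos_fin_num measurableT ig.
have := integrable_neg_fin_num measurableT ig.
rewrite /Rintegral -/(h _) [in X in _ -> _ -> X](integralE _ _ (EFin \o g)) Ep En.
rewrite (integralE _ _ h).
set P := (\int[_]_t h^\+ t)%E; set N := (\int[_]_t h^\- t)%E.
have P0 : (0 <= P)%E by apply: integral_ge0.
have N0 : (0 <= N)%E by apply: integral_ge0.
case: N N0 => [q||]//= _; last by rewrite gt0_muley.
case: P P0 => [p||]//= _; last by rewrite gt0_muley.
by move=> _ _; rewrite mulrBr.
Qed.

(** * Rescaling around w and dominated convergence *)

Section boundary_value.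
Context {R : realType} {m : nat}.
Local Notation V := 'rV[R]_m.+1.
Local Notation T := (m.+1.-tuple (measurableTypeR R)).
Local Notation row := (@row_of_tuple R m).
Local Notation leb := (@lebesgue_Rn R m.+1).
Local Notation a := ((m.+1%:R + 1) / 2 : R).
Local Notation poisson_cst := (@poisson_cst R m).
Variables (u : V -> R) (w : V).
Hypotheses (su : smooth_compact u) (w0 : Hn w).

Let aff (s : R) : T -> T := affine_tuple (w 0) s.

Let row_aff s v : row (aff s v) = w + s *: row v.
Proof. by apply/rowP => i; rewrite !mxE tnth_mktuple. Qed.

(** The integrand after the substitution z = w + s v, with v and z taken as independent: for fixed v
    the limit s -> 0 becomes continuity in z at w. *)
Let H (v : T) (z : V) : R :=
  (1 + sqr_norm v * (xlast w / xlast z)) `^ (- a) *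
  ((xlast w / xlast z) ^+ m.+1 * u z).

(** The cut to the support gives the value 0 whenever w + s v leaves H^n. *)
Let G (s : R) : T -> R := (fun v => H v (row (aff s v))) \_ (aff s @^-1` supp u).

Let a_gt0 : 0 < a.
Proof. by rewrite divr_gt0// ltr_wpDl. Qed.

Let continuous_ratio z : Hn z -> {for z, continuous (fun z : V => xlast w / xlast z)}.
Proof.
move=> z0; apply: continuousM; first exact: cst_continuous.
by apply: continuousV; [rewrite gt_eqF|exact: continuous_xlast].
Qed.

Let continuous_ratioX z : Hn z ->
  {for z, continuous (fun z : V => (xlast w / xlast z) ^+ m.+1 * u z)}.
Proof.
move=> z0; apply: continuousM; last exact: continuous_u.
apply: (continuous_comp (g := fun x : R => x ^+ m.+1)).
  exact: continuous_ratio.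
exact: exprn_continuous.
Qed.

Let base_gt0 (v : T) (z : V) : Hn z -> 0 < 1 + sqr_norm v * (xlast w / xlast z).
Proof.
move=> z0; rewrite ltr_pwDl// mulr_ge0 ?sqr_norm_ge0// divr_ge0// ltW//.
Qed.

Let continuous_H v z : Hn z -> {for z, continuous (H v)}.
Proof.
move=> z0; apply: continuousM; last exact: continuous_ratioX.
apply: (continuous_comp (g := fun x : R => x `^ (- a))).
  apply: continuousD; first exact: cst_continuous.
  by apply: continuousM; [exact: cst_continuous|exact: continuous_ratio].
by apply: continuous_powR_gt0; exact: base_gt0.
Qed.

Let G_if s v : G s v = if aff s v \in supp u then H v (row (aff s v)) else 0.
Proof.
rewrite /G patchE; suff -> : (v \in aff s @^-1` supp u) = (aff s v \in supp u) by [].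
by apply/idP/idP => /set_mem svS; exact/mem_set.
Qed.

(** In H^n the datum already vanishes off the support, so the cut does not harm continuity in
    [s]. *)
Let GE s v : Hn (row (aff s v)) -> G s v = H v (row (aff s v)).
Proof.
move=> z0; rewrite /G patchE; case: ifPn => // vS.
rewrite /H (_ : u _ = 0) ?mulr0//; apply/eqP/negPn/negP => uz.
by move/negP : vS; apply; apply/mem_set; exact: hsupport_neq0.
Qed.

(** For fixed v the point w + s v stays in the open set H^n for small s, where [G] is the continuous
    [H]. *)
Let cvg_G v : G s v @[s --> (0 : R)] --> (1 + sqr_norm v) `^ (- a) * u w.
Proof.
have -> : (1 + sqr_norm v) `^ (- a) * u w = H v w.
  by rewrite /H divff ?gt_eqF// mulr1 expr1n mul1r.
have cz : (fun s : R => w + s *: row v) @ (0 : R) --> w.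
  rewrite -[X in _ --> X]addr0 -(scale0r (row v)).
  apply: cvgD; first exact: cvg_cst.
  by apply: cvgZr_tmp; exact: cvg_id.
have nH : \forall s \near (0 : R), Hn (w + s *: row v).
  by apply: cz; apply: open_nbhs_nbhs; split => //; exact: open_Hn.
apply: (@cvg_trans _ ((H v \o (fun s : R => w + s *: row v)) @ (0 : R))).
  apply: near_eq_cvg; apply: filterS nH => s sH /=.
  by rewrite GE row_aff.
by apply: (cvg_comp (fun s : R => w + s *: row v) (H v)); [exact: cz|exact: continuous_H].
Qed.

Let dominated_G : exists2 M : R, 0 <= M &
  forall s (v : T), `|G s v| <= M * (1 + sqr_norm v) `^ (- a).
Proof.
have [e e0 eP] : exists2 e, 0 < e & forall t, supp u t -> e <= xlast w / xlast (row t).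
  apply: (gt0_supp_continuous su) continuous_ratio _ => z zS.
  by rewrite divr_gt0//; exact: (hsupport_Hn su).
have [B BP] := bounded_supp_continuous su continuous_ratioX.
(* As k is at most 1 and at most every ratio w_n/z_n on the support, 1 + |v|^2 w_n/z_n >= k (1 +
   |v|^2), uniformly in s. *)
pose k := Num.min e 1.
have k0 : 0 < k by rewrite lt_min e0/=.
exists (`|B| * k `^ (- a)); first by rewrite mulr_ge0 ?powR_ge0.
move=> s v; rewrite /G patchE; case: ifPn => [/set_mem vS|_]; last first.
  by rewrite normr0 !mulr_ge0 ?powR_ge0.
have z0 := supp_Hn su vS.
rewrite /H normrM -mulrA [leLHS]mulrC ler_pM//.
  by rewrite (le_trans (BP _ vS))// ler_norm.
rewrite ger0_norm ?powR_ge0//.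
have sv0 := sqr_norm_ge0 v.
rewrite -powRM ?(ltW k0)//; last by rewrite addr_ge0.
apply: powR_le_bound; first by rewrite mulr_gt0// ltr_pwDl.
  have ke : k <= xlast w / xlast (row (aff s v)).
    by rewrite (le_trans _ (eP _ vS))// ge_min lexx.
  rewrite mulrDr mulr1 lerD//; first by rewrite ge_min lexx orbT.
  by rewrite mulrC ler_wpM2l.
by rewrite oppr_le0 ltW.
Qed.

Let integral_profile :
  \int[leb]_v (1 + sqr_norm v) `^ (- a) = pi `^ a / Gamma a.
Proof. by rewrite /Rintegral; have [_ ->] := @Gamma_integral_poisson R m.+1. Qed.

Let integrable_profile : leb.-integrable setT (fun v : T => ((1 + sqr_norm v) `^ (- a))%:E).
Proof.
apply/integrableP; split.
  apply/measurable_EFinP/(measurableT_comp (@measurable_powR R _)).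
  by apply: measurable_funD => //; exact: measurable_sqr_norm.
under eq_integral => v _ do rewrite gee0_abs ?lee_fin ?powR_ge0//.
by have [_ ->] := @Gamma_integral_poisson R m.+1; rewrite ltry.
Qed.

Let measurable_aff s : measurable_fun setT (aff s).
Proof. exact: measurable_affine_tuple. Qed.

Let measurable_G s : measurable_fun setT (G s).
Proof.
have mD : measurable (aff s @^-1` supp u).
  by rewrite -[X in measurable X]setTI; apply: measurable_aff => //; exact: measurable_supp.
have mcomp (f : V -> R) : (forall z, Hn z -> {for z, continuous f}) ->
    measurable_fun (aff s @^-1` supp u) (fun v => f (row (aff s v))).
  move=> cf; have m1 := measurable_supp_continuous su cf.
  have sub : aff s @` (aff s @^-1` supp u) `<=` supp u by move=> _ [v ? <-].
  have m2 : measurable_fun (aff s @^-1` supp u) (aff s) by exact: measurable_funTS.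
  exact: (measurable_comp (measurable_supp u) sub m1 m2).
apply/measurable_restrict => //; rewrite setTI.
apply: measurable_funM; last exact: (mcomp _ continuous_ratioX).
apply: (measurableT_comp (f := fun x : R => x `^ (- a))); first exact: measurable_powR.
apply: measurable_funD => //; apply: measurable_funM; last exact: (mcomp _ continuous_ratio).
by apply: measurable_funTS; exact: measurable_sqr_norm.
Qed.

Let integrable_G s : leb.-integrable setT (EFin \o G s).
Proof.
have [M M0 GM] := dominated_G.
apply: (@le_integrable _ _ _ leb setT measurableT _
  (fun v => (M%:E * ((1 + sqr_norm v) `^ (- a))%:E)%E)).
- by apply/measurable_EFinP; exact: measurable_G.
- move=> v _; rewrite -EFinM /= lee_fin (le_trans (GM _ _))//; exact: ler_norm.
- exact: integrableZl.
Qed.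

Let cvg_integral_G :
  \int[leb]_v G s v @[s --> (0 : R)] --> u w * (pi `^ a / Gamma a).
Proof.
(* Dominated convergence concerns sequences, so the limit is tested along sequences tending to 0. *)
apply/(@cvg_nbhsP _ R^o) => s_ s_0.
have [M M0 GM] := dominated_G.
have -> : u w * (pi `^ a / Gamma a) = fine (\int[leb]_v (u w * (1 + sqr_norm v) `^ (- a))%:E).
  by rewrite -integral_profile -RintegralZl.
apply: fine_cvg; rewrite fineK; last first.
  apply: integrable_fin_num => //.
  by under eq_fun do rewrite EFinM; exact: integrableZl.
apply: (@dominated_cvg _ _ _ leb _ measurableT (fun k v => (G (s_ k) v)%:E) _
  (fun v => (M%:E * ((1 + sqr_norm v) `^ (- a))%:E)%E)) => //.
- by move=> k; apply/measurable_EFinP; exact: measurable_G.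
- move=> v _; apply: cvg_EFin; first exact: nearW.
  rewrite mulrC.
  exact: (cvg_comp _ _ s_0 (@cvg_G v)).
- exact: integrableZl.
- by move=> k v _; rewrite lee_fin.
Qed.

(** The substitution z = w + s v with s = 2 sin(y/2) w_n, which is positive for 0 < y < pi. *)
Let poisson_rescaled y : 0 < y < pi ->
  poisson_integral u y w =
  poisson_cst * cos (y / 2) * \int[leb]_v G (2 * sin (y / 2) * xlast w) v.
Proof.
move=> /andP[y0 ypi].
pose q := 2 * sin (y / 2).
have q0 : 0 < q by rewrite mulr_gt0// sin_gt0_pi// divr_gt0//= ltr_pdivrMr//; lra.
have s0 : 0 < q * xlast w by rewrite mulr_gt0.
have yE : y = (y / 2) *+ 2 by rewrite mulr2n; field.
have sinE : sin y = q * cos (y / 2) by rewrite {1}yE sin_mulr2n mulr2n /q; ring.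
have cosE : 2 - 2 * cos y = q ^+ 2.
  by rewrite {1}yE cos_mulr2n mulr2n cos2sin2 /q; ring.
have ns : nonsingular u y w.
  apply: cos_lt1_nonsingular => //.
  have : 0 < 2 - 2 * cos y by rewrite cosE exprn_gt0.
  lra.
rewrite poisson_integralE// Rintegral_mkcond.
rewrite (@Rintegral_affine R m.+1 (w 0) (q * xlast w))//; last first.
  rewrite (_ : EFin \o _ = (fun t => (poisson_cst * sin y *
      denom y w (row t) `^ (- a) * weight u t)%:E) \_ (supp u)); last first.
    by apply/funext => t /=; rewrite !patchE; case: ifPn.
  apply/(integrable_mkcond _ (measurable_supp u)).
  exact: (poisson_integrable su w0 ns).
have sn0 : (q * xlast w) ^+ m.+1 != 0 by rewrite expf_neq0// gt_eqF.
(* The denominator is the Jacobian s^n, which cancels at the end. *)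
pose k := poisson_cst * cos (y / 2) / (q * xlast w) ^+ m.+1.
rewrite (@eq_Rintegral _ _ _ leb setT (fun v => k * G (q * xlast w) v)); last first.
  move=> v _; rewrite G_if patchE -[affine_tuple _ _ v]/(aff _ v).
  case: ifPn => [/set_mem vS|_]; last by rewrite mulr0.
  have z0 := supp_Hn su vS; set z := row _ in z0 *.
  have zn0 : xlast z != 0 by rewrite gt_eqF.
  have xn0 : xlast w != 0 by rewrite gt_eqF.
  have dE : denom y w z = q ^+ 2 * (1 + sqr_norm v * (xlast w / xlast z)).
    rewrite /denom cosE (_ : sqr_dist w z = (q * xlast w) ^+ 2 * sqr_norm v).
      by field; rewrite zn0 xn0.
    rewrite /sqr_dist /sqr_norm mulr_sumr; apply: eq_bigr => i _.
    by rewrite /z row_aff !mxE; ring.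
  rewrite dE powRM ?exprn_ge0 ?(ltW q0)//; last exact/ltW/base_gt0.
  (* Here 2a = n + 1 = m.+2: one power of q is absorbed by sin y = q cos(y/2), the other n belong to
     the Jacobian. *)
  have -> : (q ^+ 2) `^ (- a) = (q ^+ m.+2)^-1.
    rewrite powRN -!powR_mulrn ?(ltW q0)// -powRrM; congr (_ `^ _)^-1.
    by rewrite -natr1; field.
  rewrite sinE /weight /H -/z /k; set P := _ `^ _.
  rewrite (exprMn _ q) (exprMn _ (xlast w)) exprVn (exprS q m.+1).
  have : q ^+ m.+1 != 0 by rewrite expf_neq0// gt_eqF.
  have : xlast z ^+ m.+1 != 0 by rewrite expf_neq0.
  have : xlast w ^+ m.+1 != 0 by rewrite expf_neq0.
  move: (xlast w ^+ _) (xlast z ^+ _) (q ^+ _) => X Z Qm X_neq0 Z_neq0 Qm_neq0.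
  by field; rewrite (gt_eqF q0) X_neq0 Z_neq0 Qm_neq0.
rewrite RintegralZl//.
by rewrite mulrA; congr (_ * _); rewrite /k mulrC divfK.
Qed.

Lemma poisson_integral_cvg : poisson_integral u y w @[y --> 0^'+] --> u w.
Proof.
have [C0 _] := @Gamma_integral_poisson R m.+1.
have p0 : 0 < (@pi R) `^ a by rewrite powR_gt0// pi_gt0.
(* [poisson_cst] is the inverse of the integral of the profile; the inserted 1 is the limit of
   cos(y/2). *)
have -> : u w = poisson_cst * 1 * (u w * (pi `^ a / Gamma a)).
  by rewrite /poisson_cst; field; rewrite !gt_eqF.
apply: (@cvg_trans _ (poisson_cst * cos (y / 2) *
    \int[leb]_v G (2 * sin (y / 2) * xlast w) v @[y --> 0^'+])).
  apply: near_eq_cvg; near=> y; apply/esym/poisson_rescaled; apply/andP; split => //.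
  by near: y; apply: nbhs_right_lt; exact: pi_gt0.
have chalf : (fun y : R => y / 2) @ 0^'+ --> (0 : R).
  rewrite -[X in _ --> X](mul0r 2^-1); apply: cvgMr_tmp.
  by apply: cvg_at_right_filter; exact: cvg_id.
have ccos : cos (y / 2) @[y --> 0^'+] --> (1 : R).
  rewrite -[X in _ --> X]cos0.
  exact: (@cvg_comp _ _ _ (fun y : R => y / 2) (@cos R) _ _ _ chalf (@continuous_cos R 0)).
have csin : 2 * sin (y / 2) * xlast w @[y --> 0^'+] --> 2 * 0 * xlast w.
  apply: cvgMr_tmp; apply: cvgMl_tmp; rewrite -[X in _ --> X]sin0.
  exact: (@cvg_comp _ _ _ (fun y : R => y / 2) (@sin R) _ _ _ chalf (@continuous_sin R 0)).
rewrite mulr0 mul0r in csin.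
apply: cvgM; first by apply: cvgMl_tmp.
exact: (@cvg_comp _ _ _ (fun y : R => 2 * sin (y / 2) * xlast w)
  (fun s => \int[leb]_v G s v) _ _ _ csin cvg_integral_G).
Unshelve. all: by end_near. Qed.

End boundary_value.

(* The dimension is n = m.+1. *)
Theorem theorem3p1 (R : realType) (m : nat) (U0 : 'rV[R]_m.+1 -> R) :
  smooth_compact U0 ->
  [/\ forall (y : R) (w : 'rV[R]_m.+1), 0 < y -> Hn w ->
        hintegrable (fun z => poisson_kernel y w z * U0 z),
      forall (y : R) (w : 'rV[R]_m.+1), 0 < y -> Hn w ->
        nonsingular U0 y w ->
        poisson_equation_at (poisson_integral U0) y w
    & forall w : 'rV[R]_m.+1, Hn w ->
        poisson_integral U0 y w @[y --> 0^'+] --> U0 w].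
Proof.
move=> su; split=> [y w y0 w0|y w y0 w0 ns|w w0]; last 2 first.
- exact: poisson_pde.
- exact: poisson_integral_cvg.
(* If sin y = 0 the kernel vanishes identically, even where its denominator is 0; otherwise cos y <
   1 and (y, w) is nonsingular. *)
apply: (hintegrableP su); have [siny0|siny0] := eqVneq (sin y) 0.
  rewrite (_ : (fun t => _) = cst 0%E); first exact: integrable0.
  by apply/funext => t; rewrite /poisson_kernel siny0 mul0r mulr0 mul0r.
have cosy1 : cos y < 1.
  rewrite lt_neqAle cos_le1 andbT; apply: contraNneq siny0 => cosy1.
  by rewrite -sqrf_eq0 sin2cos2 cosy1 expr1n subrr.
have ns := cos_lt1_nonsingular su w0 cosy1.
apply: eq_integrable (poisson_integrable su w0 ns).
  exact: measurable_supp.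
move=> t /set_mem /(supp_Hn su) z0.
by rewrite /poisson_kernel kernel_denominatorE// powRN mulrA.
Qed.
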